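(* Let $s\ge 1$, let $S\subset\mathbb{C}$ be an open sector with vertex at $0$, and let $f$ be a holomorphic function on $S$. Then $f\in\mathcal{O}_{(s)}(S)$ if and only if there exists a sequence of complex numbers $(a_k)_{k\ge 0}$ such that the formal series $\hat f(z)=\sum_{k=0}^\infty \frac{a_k}{k!}z^k$ is an asymptotic expansion of order $s$ of $f$ in $S$.
   Context: An open sector is a set $S=\{z\in\mathbb{C}: 0<|z|<r,\ \eta<\arg z<\theta\}$ with $r>0$ and $0<\theta-\eta\le 2\pi$. For another sector $S'$ with data $r',\eta',\theta'$, write $S'\subset\!\subset S$ if $0<r'<r$ and $\eta<\eta'<\theta'<\theta$. $\mathcal{O}_{(s)}(S)$ is the set of holomorphic functions $f$ on $S$ such that for every sector $S'\subset\!\subset S$ there are constants $M,C>0$ (possibly depending on $S'$) with $|f^{(k)}(z)|\le M C^k\, k!^{\,s}$ for all $k\ge 0$, $z\in S'$. A formal series $\hat f(z)=\sum_{k\ge0}\frac{a_k}{k!}z^k$ is an asymptotic expansion of order $s$ of $f$ in $S$ (written $f\approx_s\hat f$ in $S$) if for every sector $S'\subset\!\subset S$ there are constants $M,C>0$ with $\left|f(z)-\sum_{k=0}^{n-1}\frac{a_k}{k!}z^k\right|\le M C^n\, n!^{\,s-1}|z|^n$ for all $n\ge 0$, $z\in S'$. *)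

(* Defs.v *)
From Stdlib Require Import Reals Factorial.
From Coquelicot Require Import Coquelicot.

Open Scope R_scope.

(* The data are part of a sector, as proper inclusion below compares data. *)
Record sector : Type := Sector {
  sec_r : R;
  sec_eta : R;
  sec_theta : R;
  sec_r_pos : 0 < sec_r;
  sec_opening_pos : 0 < sec_theta - sec_eta;
  sec_opening_le : sec_theta - sec_eta <= 2 * PI
}.

Definition polar (rho phi : R) : C := (rho * cos phi, rho * sin phi).

(* [eta < arg z < theta] means that some determination [phi] of the argument
   of [z] lies in the interval. *)
Definition in_sector (S : sector) (z : C) : Prop :=
  exists rho phi : R,
    0 < rho < sec_r S /\ sec_eta S < phi < sec_theta S /\ z = polar rho phi.

(* [0 < r'] and [eta' < theta'] are fields of [S']. *)
Definition proper_subsector (S' S : sector) : Prop :=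
  sec_r S' < sec_r S /\ sec_eta S < sec_eta S' /\ sec_theta S' < sec_theta S.

(* Functions on [D] are represented by total functions, whose values outside
   [D] are irrelevant when [D] is open. *)
Definition holomorphic_on (D : C -> Prop) (f : C -> C) : Prop :=
  forall z : C, D z -> @ex_derive C_AbsRing C_NormedModule f z.

(* [C_derive] is total; it is the complex derivative wherever that exists
   (C_derive_correct, is_C_derive_unique). *)
Fixpoint C_derive_n (f : C -> C) (n : nat) : C -> C :=
  match n with
  | O => f
  | Datatypes.S m => C_derive (C_derive_n f m)
  end.

(* The class O_(s)(S). *)
Definition gevrey_class (s : R) (S : sector) (f : C -> C) : Prop :=
  holomorphic_on (in_sector S) f /\
  forall S' : sector, proper_subsector S' S ->
    exists M K : R, 0 < M /\ 0 < K /\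
      forall (k : nat) (z : C), in_sector S' z ->
        Cmod (C_derive_n f k z) <= M * K ^ k * Rpower (INR (fact k)) s.

Definition series_term (a : nat -> C) (z : C) (k : nat) : C :=
  (a k / RtoC (INR (fact k)) * z ^ k)%C.

(* Terms of index [0 .. n-1]; [sum_n u m] has the [m + 1] terms [0 .. m]. *)
Definition series_partial (a : nat -> C) (n : nat) (z : C) : C :=
  match n with
  | O => RtoC 0
  | Datatypes.S m => sum_n (series_term a z) m
  end.

(* The formal series is given by its coefficients: sum_k a_k / k! z^k. *)
Definition asymptotic_expansion
    (s : R) (S : sector) (f : C -> C) (a : nat -> C) : Prop :=
  forall S' : sector, proper_subsector S' S ->
    exists M K : R, 0 < M /\ 0 < K /\
      forall (n : nat) (z : C), in_sector S' z ->
        Cmod (f z - series_partial a n z)%C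
          <= M * K ^ n * Rpower (INR (fact n)) (s - 1) * Cmod z ^ n.

(* Main.v *)
(* If [f] has an expansion of order [s], then on a disc of radius [delta |z|]
   around [z] the remainder [f - P_n] is [O(K^n n!^(s-1) |z|^n)], and Cauchy's
   estimate for its n-th derivative, which is that of [f], costs a factor
   [n! / (delta |z|)^n]: the powers of [|z|] cancel. Conversely, bounded
   derivatives make every [f^(k)] Lipschitz along rays and arcs, so that it has
   a limit [a_k] at the vertex, and Taylor's formula along rays bounds
   [f - P_n] by [sup |f^(n)| |z|^n / n!].

   Complex differentiability of [f] gives all derivatives and Cauchy's estimate
   through Goursat's bisection argument, carried out in the parameter rectangle
   of a homotopy shrinking the circle to a point. *)

Require Import Defs.
From Stdlib Require Import Reals Lra Lia Factorial Classical.
From Coquelicot Require Import Coquelicot.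

Open Scope R_scope.

(** * Complex calculus *)

(** The order of quantifiers shapes the sector part. In an expansion the coefficients come before
    the subsector, so each [a_k] must be one limit that serves every [S']: it is taken along the
    bisector of [S], and [S'] is first enlarged to a proper subsector containing that bisector. In
    the other direction the discs around points of [S'] leave [S'], so the expansion is used on a
    sector [T] between [S'] and [S]; one relative radius [delta] works for all of [S'] because the
    distance to the boundary rays is measured by angles, which do not depend on scale. The opening
    may reach [2 * PI], so segments can leave the sector and a principal branch of the argument does
    not fit; points are kept in polar form and joined by a ray and an arc. Derivatives of all orders
    are treated as chains [F] in which [F (S k)] is the derivative of [F k]. For [f - P_n] such a
    chain is explicit, since the factorials turn differentiation of the series into a shift of its
    coefficients. The chain of a holomorphic function comes from differentiating Cauchy's integral
    under the integral sign, without power series. *)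

Lemma Cmod_sub_sym (x y : C) : Cmod (x - y) = Cmod (y - x).
Proof. rewrite <- Cmod_opp; f_equal; ring. Qed.

Lemma Cmod_sub_triangle (x y z : C) : Cmod (x - z) <= Cmod (x - y) + Cmod (y - z).
Proof.
  replace (x - z)%C with ((x - y) + (y - z))%C by ring. apply Cmod_triangle.
Qed.

Lemma Cmod_triangle_inv (x y : C) : Cmod x - Cmod y <= Cmod (x - y).
Proof.
  replace x with ((x - y) + y)%C at 1 by ring.
  generalize (Cmod_triangle (x - y) y); lra.
Qed.

Lemma Cmod_triangle_minus (x y : C) : Cmod (x - y) <= Cmod x + Cmod y.
Proof.
  unfold Cminus. rewrite <- (Cmod_opp y). apply Cmod_triangle.
Qed.

Lemma im_le_Cmod (c : C) : Rabs (Im c) <= Cmod c.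
Proof. eapply Rle_trans; [apply Rmax_r | apply (Rmax_Cmod c)]. Qed.

Lemma Cmod_le_re_im (c : C) : Cmod c <= Rabs (Re c) + Rabs (Im c).
Proof.
  replace c with (RtoC (Re c) + Ci * RtoC (Im c))%C at 1
    by (destruct c; unfold Ci, RtoC; apply injective_projections; simpl; ring).
  eapply Rle_trans; [apply Cmod_triangle|].
  rewrite Cmod_mult, Cmod_Ci, !Cmod_R; lra.
Qed.

Lemma C_eq_of_small (x y : C) : (forall eps, 0 < eps -> Cmod (x - y) <= eps) -> x = y.
Proof.
  intros H.
  assert (E : Cmod (x - y) = 0).
  { apply Rle_antisym; [|apply Cmod_ge_0].
    apply le_epsilon; intros e He; rewrite Rplus_0_l; auto. }
  apply Cmod_eq_0 in E.
  replace x with ((x - y) + y)%C by ring. rewrite E; ring.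
Qed.

(** Rotating [D] onto the positive real axis, by [Cconj D / Cmod D], replaces its modulus by a real
    part. Mean value and integral bounds for complex functions thereby reduce to the real ones. *)
Lemma exists_unit_Re (D : C) : exists u : C, Cmod u = 1 /\ Re (u * D)%C = Cmod D.
Proof.
  destruct (Req_dec (Cmod D) 0) as [E|E].
  - exists (RtoC 1). rewrite Cmod_1; split; auto.
    rewrite E. rewrite (Cmod_eq_0 _ E), Cmult_0_r. reflexivity.
  - assert (D <> RtoC 0) by (intros ->; apply E, Cmod_0).
    exists (Cconj D / RtoC (Cmod D))%C. split.
    + rewrite Cmod_div, Cmod_conj, Cmod_R, Rabs_pos_eq; [field; auto|apply Cmod_ge_0|].
      intros K; apply RtoC_inj in K; auto.
    + replace (Cconj D / RtoC (Cmod D) * D)%C with (RtoC (Cmod D)); auto.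
      replace (Cconj D / RtoC (Cmod D) * D)%C with ((D * Cconj D) / RtoC (Cmod D))%C
        by (field; intros K; apply RtoC_inj in K; auto).
      rewrite <- Cmod2_conj, RtoC_pow. field.
      intros K; apply RtoC_inj in K; auto.
Qed.

(** The remainder form avoids division, so [w = z] needs no exception, and [l] is data: sums,
    products and chains are built before any appeal to the total function [C_derive]. *)
Definition cdiff (f : C -> C) (z l : C) : Prop :=
  forall eps, 0 < eps -> exists delta, 0 < delta /\
    forall w, Cmod (w - z) < delta ->
      Cmod (f w - f z - l * (w - z)) <= eps * Cmod (w - z).

Lemma is_derive_cdiff (f : C -> C) (z l : C) :
  @is_derive C_AbsRing C_NormedModule f z l <-> cdiff f z l.
Proof.
  split.
  - intros [_ H] eps He.
    destruct (H z (fun P HP => HP) (mkposreal eps He)) as [d Hd].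
    exists d; split; [apply cond_pos|].
    intros w Hw. specialize (Hd w Hw). simpl in Hd.
    change (Cmod (f w - f z - (w - z) * l) <= eps * Cmod (w - z)) in Hd.
    rewrite (Cmult_comm l); exact Hd.
  - intros H. split.
    + apply (is_linear_scal_l (K := C_AbsRing) (V := C_NormedModule) l).
    + intros x Hx.
      assert (E : z = x)
        by (apply (is_filter_lim_locally_unique
               (K := C_AbsRing) (V := AbsRing_NormedModule C_AbsRing) z x Hx)).
      subst x. intros eps.
      destruct (H eps (cond_pos eps)) as [d [Hd H']].
      exists (mkposreal d Hd). intros w Hw.
      change (Cmod (f w - f z - (w - z) * l) <= eps * Cmod (w - z)).
      rewrite (Cmult_comm (w - z)). apply H', Hw.
Qed.

Lemma cdiff_unique (f : C -> C) (z l : C) : cdiff f z l -> C_derive f z = l.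
Proof. intros H. apply is_C_derive_unique, is_derive_cdiff, H. Qed.

Lemma cdiff_ext_loc (f g : C -> C) (z l : C) (d : R) :
  0 < d -> (forall w, Cmod (w - z) < d -> f w = g w) -> cdiff f z l -> cdiff g z l.
Proof.
  intros Hd E H eps He. destruct (H eps He) as [d' [Hd' H']].
  exists (Rmin d d'); split; [apply Rmin_glb_lt; auto|].
  intros w Hw.
  rewrite <- E by (eapply Rlt_le_trans; [exact Hw|apply Rmin_l]).
  rewrite <- E by (replace (z - z)%C with (RtoC 0) by ring; rewrite Cmod_0; auto).
  apply H'. eapply Rlt_le_trans; [exact Hw|apply Rmin_r].
Qed.

Lemma cdiff_lipschitz (f : C -> C) (z l : C) :
  cdiff f z l -> exists d, 0 < d /\ forall w, Cmod (w - z) < d ->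
    Cmod (f w - f z) <= (Cmod l + 1) * Cmod (w - z).
Proof.
  intros H. destruct (H 1 Rlt_0_1) as [d [Hd H']]. exists d; split; auto.
  intros w Hw.
  replace (f w - f z)%C with ((f w - f z - l * (w - z)) + l * (w - z))%C by ring.
  eapply Rle_trans; [apply Cmod_triangle|]. rewrite Cmod_mult.
  generalize (H' w Hw); lra.
Qed.

Lemma cdiff_const (c z : C) : cdiff (fun _ => c) z 0.
Proof.
  intros eps He. exists 1; split; [lra|]. intros w _.
  replace (c - c - 0 * (w - z))%C with (RtoC 0) by ring.
  rewrite Cmod_0. apply Rmult_le_pos; [lra|apply Cmod_ge_0].
Qed.

Lemma cdiff_id (z : C) : cdiff (fun w => w) z 1.
Proof.
  intros eps He. exists 1; split; [lra|]. intros w _.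
  replace (w - z - 1 * (w - z))%C with (RtoC 0) by ring.
  rewrite Cmod_0. apply Rmult_le_pos; [lra|apply Cmod_ge_0].
Qed.

Lemma cdiff_plus (f g : C -> C) (z l m : C) :
  cdiff f z l -> cdiff g z m -> cdiff (fun w => f w + g w)%C z (l + m).
Proof.
  intros Hf Hg eps He.
  destruct (Hf (eps / 2)) as [d1 [Hd1 H1]]; [lra|].
  destruct (Hg (eps / 2)) as [d2 [Hd2 H2]]; [lra|].
  exists (Rmin d1 d2); split; [apply Rmin_glb_lt; auto|]. intros w Hw.
  replace (f w + g w - (f z + g z) - (l + m) * (w - z))%C
    with ((f w - f z - l * (w - z)) + (g w - g z - m * (w - z)))%C by ring.
  eapply Rle_trans; [apply Cmod_triangle|].
  assert (Cmod (w - z) < d1) by (eapply Rlt_le_trans; [exact Hw|apply Rmin_l]).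
  assert (Cmod (w - z) < d2) by (eapply Rlt_le_trans; [exact Hw|apply Rmin_r]).
  generalize (H1 w ltac:(auto)) (H2 w ltac:(auto)); lra.
Qed.

Lemma cdiff_scal (c : C) (f : C -> C) (z l : C) :
  cdiff f z l -> cdiff (fun w => c * f w)%C z (c * l).
Proof.
  intros Hf eps He.
  assert (Hc := Cmod_ge_0 c).
  destruct (Hf (eps / (Cmod c + 1))) as [d1 [Hd1 H1]]; [apply Rdiv_lt_0_compat; lra|].
  exists d1; split; auto. intros w Hw.
  replace (c * f w - c * f z - c * l * (w - z))%C
    with (c * (f w - f z - l * (w - z)))%C by ring.
  rewrite Cmod_mult.
  apply Rle_trans with (Cmod c * (eps / (Cmod c + 1) * Cmod (w - z))).
  - apply Rmult_le_compat_l; auto.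
  - replace (Cmod c * (eps / (Cmod c + 1) * Cmod (w - z)))
      with (Cmod c / (Cmod c + 1) * (eps * Cmod (w - z))) by (field; lra).
    rewrite <- (Rmult_1_l (eps * Cmod (w - z))) at 2.
    apply Rmult_le_compat_r.
    + apply Rmult_le_pos; [lra|apply Cmod_ge_0].
    + apply Rle_div_l; lra.
Qed.

Lemma cdiff_minus (f g : C -> C) (z l m : C) :
  cdiff f z l -> cdiff g z m -> cdiff (fun w => f w - g w)%C z (l - m).
Proof.
  intros Hf Hg.
  replace (l - m)%C with (l + (-1) * m)%C by ring.
  apply cdiff_ext_loc with (f := fun w => (f w + (-1) * g w)%C) (d := 1); [lra| |].
  - intros w _; ring.
  - apply cdiff_plus; auto. apply cdiff_scal; auto.
Qed.

(* [f g - f(z) g(z) - (l g(z) + f(z) m)(w-z)] is the sum of [g(z)] times the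
   remainder of [f], [f(w)] times the remainder of [g], and [(f(w)-f(z)) m (w-z)]. *)
Lemma cdiff_mult (f g : C -> C) (z l m : C) :
  cdiff f z l -> cdiff g z m -> cdiff (fun w => f w * g w)%C z (l * g z + f z * m).
Proof.
  intros Hf Hg eps He.
  destruct (cdiff_lipschitz f z l Hf) as [d0 [Hd0 H0]].
  set (A := Cmod (g z) + Cmod (f z) + 1 + (Cmod l + 1) * (Cmod m + 1)).
  assert (Hfz := Cmod_ge_0 (f z)); assert (Hgz := Cmod_ge_0 (g z)).
  assert (Hl := Cmod_ge_0 l); assert (Hm := Cmod_ge_0 m).
  assert (HA : 1 <= A).
  { unfold A. assert (0 <= (Cmod l + 1) * (Cmod m + 1)) by (apply Rmult_le_pos; lra). lra. }
  set (e := eps / (3 * A)).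
  assert (Hepos : 0 < e) by (apply Rdiv_lt_0_compat; lra).
  assert (HeA : e * A = eps / 3) by (unfold e; field; lra).
  destruct (Hf e Hepos) as [d1 [Hd1 H1]].
  destruct (Hg e Hepos) as [d2 [Hd2 H2]].
  set (d := Rmin (Rmin d0 d1) (Rmin d2 (Rmin e (/ (Cmod l + 1))))).
  assert (Hinv : 0 < / (Cmod l + 1)) by (apply Rinv_0_lt_compat; lra).
  exists d; split.
  { unfold d; repeat apply Rmin_glb_lt; auto. }
  intros w Hw.
  set (x := Cmod (w - z)) in *.
  assert (Hx : 0 <= x) by apply Cmod_ge_0.
  assert (x < d0 /\ x < d1 /\ x < d2 /\ x < e /\ x < / (Cmod l + 1)) as (X0 & X1 & X2 & X3 & X4).
  { unfold d in Hw. repeat split; eapply Rlt_le_trans; try exact Hw.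
    - eapply Rle_trans; apply Rmin_l.
    - eapply Rle_trans; [apply Rmin_l|apply Rmin_r].
    - eapply Rle_trans; [apply Rmin_r|apply Rmin_l].
    - eapply Rle_trans; [apply Rmin_r|]. eapply Rle_trans; [apply Rmin_r|apply Rmin_l].
    - eapply Rle_trans; [apply Rmin_r|]. eapply Rle_trans; [apply Rmin_r|apply Rmin_r]. }
  specialize (H0 w X0). specialize (H1 w X1). specialize (H2 w X2).
  fold x in H0, H1, H2.
  assert (Hl1 : (Cmod l + 1) * x <= 1).
  { apply Rmult_le_reg_l with (/ (Cmod l + 1)); auto.
    rewrite <- Rmult_assoc, Rinv_l, Rmult_1_l, Rmult_1_r by lra. lra. }
  assert (Hfw : Cmod (f w) <= Cmod (f z) + 1).
  { generalize (Cmod_triangle_inv (f w) (f z)); lra. }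
  replace (f w * g w - f z * g z - (l * g z + f z * m) * (w - z))%C
    with (g z * (f w - f z - l * (w - z)) + f w * (g w - g z - m * (w - z))
          + (f w - f z) * (m * (w - z)))%C by ring.
  eapply Rle_trans; [apply Cmod_triangle|].
  eapply Rle_trans; [apply Rplus_le_compat_r, Cmod_triangle|].
  rewrite !Cmod_mult. fold x.
  assert (T1 : Cmod (g z) * Cmod (f w - f z - l * (w - z)) <= Cmod (g z) * (e * x))
    by (apply Rmult_le_compat_l; auto).
  assert (T2 : Cmod (f w) * Cmod (g w - g z - m * (w - z)) <= (Cmod (f z) + 1) * (e * x))
    by (apply Rmult_le_compat; auto using Cmod_ge_0).
  assert (T3 : Cmod (f w - f z) * (Cmod m * x) <= (Cmod l + 1) * x * (Cmod m * x))
    by (apply Rmult_le_compat_r; auto; apply Rmult_le_pos; auto).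
  assert (T4 : (Cmod l + 1) * x * (Cmod m * x) <= (Cmod l + 1) * (Cmod m + 1) * (e * x)).
  { replace ((Cmod l + 1) * x * (Cmod m * x)) with ((Cmod l + 1) * Cmod m * (x * x)) by ring.
    apply Rmult_le_compat.
    - apply Rmult_le_pos; lra.
    - apply Rmult_le_pos; lra.
    - apply Rmult_le_compat_l; lra.
    - apply Rmult_le_compat_r; lra. }
  assert (T5 : (Cmod (g z) + (Cmod (f z) + 1) + (Cmod l + 1) * (Cmod m + 1)) * (e * x)
               = eps / 3 * x) by (rewrite <- HeA; unfold A; ring).
  assert (0 <= eps * x) by (apply Rmult_le_pos; lra).
  lra.
Qed.

Lemma cdiff_pow_S (n : nat) (z : C) :
  cdiff (fun w => w ^ S n)%C z (RtoC (INR (S n)) * z ^ n).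
Proof.
  induction n as [|n IH].
  - simpl (z ^ 0)%C. replace (RtoC (INR 1) * 1)%C with (RtoC 1) by (simpl; ring).
    apply cdiff_ext_loc with (f := fun w => w) (d := 1); [lra| |apply cdiff_id].
    intros w _. simpl. ring.
  - replace (RtoC (INR (S (S n))) * z ^ S n)%C
      with (1 * z ^ S n + z * (RtoC (INR (S n)) * z ^ n))%C.
    + apply (cdiff_mult (fun w => w) (fun w => w ^ S n)%C); [apply cdiff_id|apply IH].
    + rewrite (S_INR (S n)), RtoC_plus, !Cpow_S. ring.
Qed.

(* [1/w - 1/z + (w-z)/z^2 = (w-z)^2 / (w z^2)], and [|w| >= |z|/2] near [z]. *)
Lemma cdiff_inv (z : C) : z <> RtoC 0 -> cdiff Cinv z (- (/ (z * z))).
Proof.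
  intros Hz eps He.
  assert (P : 0 < Cmod z) by (apply Cmod_gt_0; auto).
  set (p := Cmod z) in *.
  exists (Rmin (p / 2) (eps * p ^ 3 / 2)); split.
  { apply Rmin_glb_lt; [lra|]. assert (0 < p ^ 3) by (apply pow_lt; auto).
    assert (0 < eps * p ^ 3) by (apply Rmult_lt_0_compat; auto). lra. }
  intros w Hw. set (x := Cmod (w - z)) in *.
  assert (X1 : x < p / 2) by (eapply Rlt_le_trans; [exact Hw|apply Rmin_l]).
  assert (X2 : x < eps * p ^ 3 / 2) by (eapply Rlt_le_trans; [exact Hw|apply Rmin_r]).
  assert (Hx : 0 <= x) by apply Cmod_ge_0.
  assert (Q : p / 2 < Cmod w).
  { generalize (Cmod_triangle_inv z w). rewrite Cmod_sub_sym. fold x p. lra. }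
  assert (Hw0 : w <> RtoC 0) by (apply Cmod_gt_0; lra).
  replace (/ w - / z - - / (z * z) * (w - z))%C
    with ((w - z) * (w - z) * / (w * (z * z)))%C by (field; auto).
  rewrite !Cmod_mult, Cmod_inv by (repeat apply Cmult_neq_0; auto).
  rewrite !Cmod_mult. fold x p.
  apply Rle_trans with (x * x * (2 / p ^ 3)).
  - apply Rmult_le_compat_l; [apply Rmult_le_pos; auto|].
    replace (2 / p ^ 3) with (/ (p / 2 * (p * p))) by (field; lra).
    apply Rinv_le_contravar.
    + repeat apply Rmult_lt_0_compat; lra.
    + apply Rmult_le_compat_r; [apply Rmult_le_pos|]; lra.
  - replace (x * x * (2 / p ^ 3)) with (x * 2 / p ^ 3 * x) by (field; lra).
    apply Rmult_le_compat_r; auto.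
    assert (0 < p ^ 3) by (apply pow_lt; auto).
    apply Rle_div_l; lra.
Qed.

(** * Differentiation along curves *)

Definition rdiff (F : R -> C) (t : R) (l : C) : Prop :=
  is_derive (fun s => Re (F s)) t (Re l) /\ is_derive (fun s => Im (F s)) t (Im l).

Lemma is_derive_R_eps (f : R -> R) (t l : R) :
  is_derive f t l <->
  forall eps, 0 < eps -> exists delta, 0 < delta /\
    forall s, Rabs (s - t) < delta -> Rabs (f s - f t - l * (s - t)) <= eps * Rabs (s - t).
Proof.
  split.
  - intros [_ H] eps He.
    destruct (H t (fun P HP => HP) (mkposreal eps He)) as [d Hd].
    exists d; split; [apply cond_pos|]. intros s Hs.
    specialize (Hd s Hs).
    change (Rabs (f s - f t - (s - t) * l) <= eps * Rabs (s - t)) in Hd.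
    rewrite (Rmult_comm l); exact Hd.
  - intros H. split; [apply (is_linear_scal_l (K := R_AbsRing) (V := R_NormedModule) l)|].
    intros x Hx.
    assert (E : t = x) by (apply (is_filter_lim_locally_unique
               (K := R_AbsRing) (V := AbsRing_NormedModule R_AbsRing) t x Hx)).
    subst x. intros eps. destruct (H eps (cond_pos eps)) as [d [Hd H']].
    exists (mkposreal d Hd). intros s Hs.
    change (Rabs (f s - f t - (s - t) * l) <= eps * Rabs (s - t)).
    rewrite (Rmult_comm (s - t)). apply H', Hs.
Qed.

(** Both forms are needed: the components give access to the real mean value theorem and the real
    integral, the complex remainder gives the chain rule. *)
Lemma rdiff_eps (F : R -> C) (t : R) (l : C) :
  rdiff F t l <->
  forall eps, 0 < eps -> exists delta, 0 < delta /\
    forall s, Rabs (s - t) < delta ->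
      Cmod (F s - F t - l * RtoC (s - t)) <= eps * Rabs (s - t).
Proof.
  assert (ER : forall s, Re (F s - F t - l * RtoC (s - t))%C
                       = Re (F s) - Re (F t) - Re l * (s - t)).
  { intros s. destruct (F s), (F t), l; unfold RtoC; simpl; ring. }
  assert (EI : forall s, Im (F s - F t - l * RtoC (s - t))%C
                       = Im (F s) - Im (F t) - Im l * (s - t)).
  { intros s. destruct (F s), (F t), l; unfold RtoC; simpl; ring. }
  unfold rdiff. rewrite !is_derive_R_eps. split.
  - intros [H1 H2] eps He.
    destruct (H1 (eps / 2)) as [d1 [Hd1 K1]]; [lra|].
    destruct (H2 (eps / 2)) as [d2 [Hd2 K2]]; [lra|].
    exists (Rmin d1 d2); split; [apply Rmin_glb_lt; auto|]. intros s Hs.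
    eapply Rle_trans; [apply Cmod_le_re_im|]. rewrite ER, EI.
    assert (Rabs (s - t) < d1) by (eapply Rlt_le_trans; [exact Hs|apply Rmin_l]).
    assert (Rabs (s - t) < d2) by (eapply Rlt_le_trans; [exact Hs|apply Rmin_r]).
    generalize (K1 s ltac:(auto)) (K2 s ltac:(auto)); lra.
  - intros H; split; intros eps He; destruct (H eps He) as [d [Hd K]];
      exists d; split; auto; intros s Hs.
    + rewrite <- ER. eapply Rle_trans; [apply re_le_Cmod|auto].
    + rewrite <- EI. eapply Rle_trans; [apply im_le_Cmod|auto].
Qed.

Lemma rdiff_lipschitz (F : R -> C) (t : R) (l : C) :
  rdiff F t l -> exists d, 0 < d /\ forall s, Rabs (s - t) < d ->
    Cmod (F s - F t) <= (Cmod l + 1) * Rabs (s - t).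
Proof.
  intros H. apply rdiff_eps with (eps := 1) in H; [|lra].
  destruct H as [d [Hd H']]. exists d; split; auto.
  intros s Hs.
  replace (F s - F t)%C with ((F s - F t - l * RtoC (s - t)) + l * RtoC (s - t))%C by ring.
  eapply Rle_trans; [apply Cmod_triangle|]. rewrite Cmod_mult, Cmod_R.
  generalize (H' s Hs); lra.
Qed.

Lemma rdiff_comp (f : C -> C) (F : R -> C) (t : R) (l m : C) :
  cdiff f (F t) l -> rdiff F t m -> rdiff (fun s => f (F s)) t (l * m).
Proof.
  intros Hf HF. apply rdiff_eps. intros eps He.
  assert (Hl := Cmod_ge_0 l); assert (Hm := Cmod_ge_0 m).
  destruct (rdiff_lipschitz F t m HF) as [d0 [Hd0 H0]].
  destruct (Hf (eps / 2 / (Cmod m + 1))) as [d1 [Hd1 H1]].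
  { apply Rdiv_lt_0_compat; lra. }
  apply rdiff_eps with (eps := eps / 2 / (Cmod l + 1)) in HF;
    [|apply Rdiv_lt_0_compat; lra].
  destruct HF as [d2 [Hd2 H2]].
  assert (P : 0 < d1 / (Cmod m + 1)) by (apply Rdiv_lt_0_compat; lra).
  exists (Rmin d0 (Rmin (d1 / (Cmod m + 1)) d2)); split; [repeat apply Rmin_glb_lt; auto|].
  intros s Hs. set (x := Rabs (s - t)) in *.
  assert (Hx : 0 <= x) by apply Rabs_pos.
  assert (x < d0 /\ x < d1 / (Cmod m + 1) /\ x < d2) as (X0 & X1 & X2).
  { repeat split; eapply Rlt_le_trans; try exact Hs.
    - apply Rmin_l.
    - eapply Rle_trans; [apply Rmin_r|apply Rmin_l].
    - eapply Rle_trans; [apply Rmin_r|apply Rmin_r]. }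
  specialize (H0 s X0). specialize (H2 s X2). fold x in H0, H2.
  assert (Y : (Cmod m + 1) * x < d1).
  { apply Rlt_div_r in X1; lra. }
  specialize (H1 (F s) ltac:(lra)).
  replace (f (F s) - f (F t) - l * m * RtoC (s - t))%C
    with ((f (F s) - f (F t) - l * (F s - F t)) + l * (F s - F t - m * RtoC (s - t)))%C by ring.
  eapply Rle_trans; [apply Cmod_triangle|]. rewrite Cmod_mult.
  assert (T1 : eps / 2 / (Cmod m + 1) * Cmod (F s - F t) <= eps / 2 * x).
  { apply Rle_trans with (eps / 2 / (Cmod m + 1) * ((Cmod m + 1) * x)).
    - apply Rmult_le_compat_l; auto. apply Rlt_le, Rdiv_lt_0_compat; lra.
    - apply Req_le; field; lra. }
  assert (T2 : Cmod l * Cmod (F s - F t - m * RtoC (s - t)) <= eps / 2 * x).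
  { apply Rle_trans with ((Cmod l + 1) * (eps / 2 / (Cmod l + 1) * x)).
    - apply Rmult_le_compat; auto using Cmod_ge_0; lra.
    - apply Req_le; field; lra. }
  lra.
Qed.

Lemma rdiff_line (z v : C) (t : R) : rdiff (fun s => z + RtoC s * v)%C t v.
Proof.
  destruct z as [z1 z2], v as [v1 v2].
  split; unfold RtoC; simpl; auto_derive; auto; ring.
Qed.

Lemma rdiff_polar_radius (phi rho : R) : rdiff (fun t => polar t phi) rho (polar 1 phi).
Proof. split; unfold polar; simpl; auto_derive; auto; ring. Qed.

Lemma rdiff_polar_angle (rho phi : R) : rdiff (polar rho) phi (Ci * polar rho phi).
Proof. split; unfold polar, Ci; simpl; auto_derive; auto; ring. Qed.

Lemma Cmod_polar (rho phi : R) : Cmod (polar rho phi) = Rabs rho.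
Proof.
  unfold Cmod, polar; simpl fst; simpl snd.
  replace ((rho * cos phi) ^ 2 + (rho * sin phi) ^ 2)
    with (Rsqr rho * (Rsqr (sin phi) + Rsqr (cos phi))) by (unfold Rsqr; ring).
  rewrite sin2_cos2, Rmult_1_r. apply sqrt_Rsqr_abs.
Qed.

(** With [u] rotating [F b - F a] onto the positive axis, [g - Re (u F)] has a nonnegative
    derivative, and the real mean value theorem applies to it. A general majorant [g] is allowed
    because Taylor's estimate needs a bound growing like a power of [t]. *)
Lemma mean_value_inequality (F dF : R -> C) (g dg : R -> R) (a b : R) :
  a <= b ->
  (forall t, a <= t <= b -> rdiff F t (dF t)) ->
  (forall t, a <= t <= b -> is_derive g t (dg t)) ->
  (forall t, a <= t <= b -> Cmod (dF t) <= dg t) ->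
  Cmod (F b - F a) <= g b - g a.
Proof.
  intros Hab HF Hg Hle.
  destruct (exists_unit_Re (F b - F a)%C) as [[u1 u2] [Hu Hu']].
  set (h := fun t => g t - (u1 * Re (F t) - u2 * Im (F t))).
  set (dh := fun t => dg t - (u1 * Re (dF t) - u2 * Im (dF t))).
  assert (Hh : forall t, a <= t <= b -> is_derive h t (dh t)).
  { intros t Ht. destruct (HF t Ht) as [H1 H2]. specialize (Hg t Ht).
    unfold h, dh. apply (is_derive_minus (V := R_NormedModule)); auto.
    apply (is_derive_minus (V := R_NormedModule)).
    - apply (is_derive_scal (fun t => Re (F t))); auto.
    - apply (is_derive_scal (fun t => Im (F t))); auto. }
  destruct (MVT_gen h a b dh) as [c [Hc E]];
    rewrite ?Rmin_left, ?Rmax_right in * by auto.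
  - intros x Hx; apply Hh; lra.
  - intros x Hx. apply continuity_pt_filterlim.
    apply (ex_derive_continuous (V := R_NormedModule)). exists (dh x); apply Hh; lra.
  - assert (0 <= dh c).
    { unfold dh. specialize (Hle c Hc).
      assert (u1 * Re (dF c) - u2 * Im (dF c) <= Cmod (dF c)); [|lra].
      replace (u1 * Re (dF c) - u2 * Im (dF c)) with (Re ((u1, u2) * dF c)%C)
        by (destruct (dF c); reflexivity).
      eapply Rle_trans; [apply Rle_abs|]. eapply Rle_trans; [apply re_le_Cmod|].
      rewrite Cmod_mult, Hu; lra. }
    assert (0 <= h b - h a) by (rewrite E; apply Rmult_le_pos; lra).
    rewrite <- Hu'. unfold h in *. destruct (F b), (F a); simpl in *. lra.
Qed.

(** * Continuity and integrals of complex functions of a real variable *)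

Definition ccont (F : R -> C) (t : R) : Prop :=
  forall eps, 0 < eps -> exists delta, 0 < delta /\
    forall s, Rabs (s - t) < delta -> Cmod (F s - F t) < eps.

Lemma ccont_Re (F : R -> C) (t : R) : ccont F t -> continuous (fun s => Re (F s)) t.
Proof.
  intros H. apply (filterlim_locally (U := R_UniformSpace)). intros eps.
  destruct (H eps (cond_pos eps)) as [d [Hd K]].
  exists (mkposreal d Hd). intros s Hs. specialize (K s Hs).
  change (Rabs (Re (F s) - Re (F t)) < eps).
  eapply Rle_lt_trans; [|exact K].
  replace (Re (F s) - Re (F t)) with (Re (F s - F t)%C)
    by (destruct (F s), (F t); reflexivity).
  apply re_le_Cmod.
Qed.

Lemma ccont_Im (F : R -> C) (t : R) : ccont F t -> continuous (fun s => Im (F s)) t.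
Proof.
  intros H. apply (filterlim_locally (U := R_UniformSpace)). intros eps.
  destruct (H eps (cond_pos eps)) as [d [Hd K]].
  exists (mkposreal d Hd). intros s Hs. specialize (K s Hs).
  change (Rabs (Im (F s) - Im (F t)) < eps).
  eapply Rle_lt_trans; [|exact K].
  replace (Im (F s) - Im (F t)) with (Im (F s - F t)%C)
    by (destruct (F s), (F t); reflexivity).
  apply im_le_Cmod.
Qed.

Lemma ccont_const (c : C) (t : R) : ccont (fun _ => c) t.
Proof.
  intros eps He. exists 1; split; [lra|]. intros s _.
  replace (c - c)%C with (RtoC 0) by ring. rewrite Cmod_0; auto.
Qed.

Lemma ccont_rdiff (F : R -> C) (t : R) (l : C) : rdiff F t l -> ccont F t.
Proof.
  intros H eps He. destruct (rdiff_lipschitz F t l H) as [d [Hd K]].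
  assert (Hl := Cmod_ge_0 l).
  assert (0 < eps / (Cmod l + 1)) by (apply Rdiv_lt_0_compat; lra).
  exists (Rmin d (eps / (Cmod l + 1))); split; [apply Rmin_glb_lt; auto|].
  intros s Hs.
  assert (Rabs (s - t) < d) by (eapply Rlt_le_trans; [exact Hs|apply Rmin_l]).
  assert (X : Rabs (s - t) < eps / (Cmod l + 1))
    by (eapply Rlt_le_trans; [exact Hs|apply Rmin_r]).
  apply Rlt_div_r in X; [|lra]. specialize (K s ltac:(auto)). lra.
Qed.

Lemma ccont_plus (F G : R -> C) (t : R) :
  ccont F t -> ccont G t -> ccont (fun s => F s + G s)%C t.
Proof.
  intros HF HG eps He.
  destruct (HF (eps / 2)) as [d1 [Hd1 K1]]; [lra|].
  destruct (HG (eps / 2)) as [d2 [Hd2 K2]]; [lra|].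
  exists (Rmin d1 d2); split; [apply Rmin_glb_lt; auto|]. intros s Hs.
  replace (F s + G s - (F t + G t))%C with ((F s - F t) + (G s - G t))%C by ring.
  eapply Rle_lt_trans; [apply Cmod_triangle|].
  assert (Rabs (s - t) < d1) by (eapply Rlt_le_trans; [exact Hs|apply Rmin_l]).
  assert (Rabs (s - t) < d2) by (eapply Rlt_le_trans; [exact Hs|apply Rmin_r]).
  generalize (K1 s ltac:(auto)) (K2 s ltac:(auto)); lra.
Qed.

Lemma ccont_mult (F G : R -> C) (t : R) :
  ccont F t -> ccont G t -> ccont (fun s => F s * G s)%C t.
Proof.
  intros HF HG eps He.
  set (A := Cmod (F t) + Cmod (G t) + 2).
  assert (HFt := Cmod_ge_0 (F t)); assert (HGt := Cmod_ge_0 (G t)).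
  assert (P : 0 < eps / A) by (apply Rdiv_lt_0_compat; unfold A; lra).
  set (e := Rmin 1 (eps / A)).
  assert (Pe : 0 < e) by (apply Rmin_glb_lt; lra).
  assert (e1 : e <= 1) by apply Rmin_l. assert (eA : e <= eps / A) by apply Rmin_r.
  apply Rle_div_r in eA; [|unfold A; lra].
  destruct (HF e Pe) as [d1 [Hd1 K1]].
  destruct (HG e Pe) as [d2 [Hd2 K2]].
  exists (Rmin d1 d2); split; [apply Rmin_glb_lt; auto|]. intros s Hs.
  assert (X1 : Rabs (s - t) < d1) by (eapply Rlt_le_trans; [exact Hs|apply Rmin_l]).
  assert (X2 : Rabs (s - t) < d2) by (eapply Rlt_le_trans; [exact Hs|apply Rmin_r]).
  specialize (K1 s X1). specialize (K2 s X2).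
  replace (F s * G s - F t * G t)%C
    with ((F s - F t) * G t + (F s - F t) * (G s - G t) + F t * (G s - G t))%C by ring.
  eapply Rle_lt_trans; [apply Cmod_triangle|].
  eapply Rle_lt_trans; [apply Rplus_le_compat_r, Cmod_triangle|].
  rewrite !Cmod_mult.
  assert (Cmod (F s - F t) * Cmod (G t) <= e * Cmod (G t))
    by (apply Rmult_le_compat_r; lra).
  assert (Cmod (F s - F t) * Cmod (G s - G t) <= e * 1)
    by (apply Rmult_le_compat; auto using Cmod_ge_0; lra).
  assert (Cmod (F t) * Cmod (G s - G t) <= Cmod (F t) * e)
    by (apply Rmult_le_compat_l; lra).
  unfold A in eA. lra.
Qed.

Lemma ccont_minus (F G : R -> C) (t : R) :
  ccont F t -> ccont G t -> ccont (fun s => F s - G s)%C t.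
Proof.
  intros HF HG eps He.
  destruct (ccont_plus F (fun s => - (1) * G s)%C t HF
              (ccont_mult _ G t (ccont_const _ t) HG) eps He) as [d [Hd K]].
  exists d; split; auto. intros s Hs.
  replace (F s - G s - (F t - G t))%C
    with (F s + - (1) * G s - (F t + - (1) * G t))%C by ring. auto.
Qed.

Lemma ccont_comp (f : C -> C) (F : R -> C) (t : R) (l : C) :
  cdiff f (F t) l -> ccont F t -> ccont (fun s => f (F s)) t.
Proof.
  intros Hf HF eps He. destruct (cdiff_lipschitz f (F t) l Hf) as [d [Hd K]].
  assert (Hl := Cmod_ge_0 l).
  assert (P : 0 < eps / (Cmod l + 1)) by (apply Rdiv_lt_0_compat; lra).
  destruct (HF (Rmin d (eps / (Cmod l + 1)))) as [d' [Hd' K']];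
    [apply Rmin_glb_lt; auto|].
  exists d'; split; auto. intros s Hs. specialize (K' s Hs).
  assert (X1 : Cmod (F s - F t) < d) by (eapply Rlt_le_trans; [exact K'|apply Rmin_l]).
  assert (X2 : Cmod (F s - F t) < eps / (Cmod l + 1))
    by (eapply Rlt_le_trans; [exact K'|apply Rmin_r]).
  apply Rlt_div_r in X2; [|lra]. specialize (K (F s) X1). lra.
Qed.

Lemma ccont_pow (F : R -> C) (n : nat) (t : R) : ccont F t -> ccont (fun s => F s ^ n)%C t.
Proof.
  intros H. induction n as [|n IH]; simpl.
  - apply ccont_const.
  - apply (ccont_mult F (fun s => F s ^ n)%C); auto.
Qed.

Definition cint (F : R -> C) (a b : R) : C :=
  (RInt (fun t => Re (F t)) a b, RInt (fun t => Im (F t)) a b).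

(** Continuity is two-sided even at the endpoints. The curves below are defined on the whole line
    and the functions are differentiable at each point of the curve, so this costs nothing. *)
Definition ccont_on (F : R -> C) (a b : R) : Prop := forall t, a <= t <= b -> ccont F t.

Lemma ccont_on_Re_int (F : R -> C) (a b : R) :
  a <= b -> ccont_on F a b -> ex_RInt (fun t => Re (F t)) a b.
Proof.
  intros Hab H. apply (ex_RInt_continuous (V := R_CompleteNormedModule)).
  rewrite Rmin_left, Rmax_right by auto. intros t Ht. apply ccont_Re, H, Ht.
Qed.

Lemma ccont_on_Im_int (F : R -> C) (a b : R) :
  a <= b -> ccont_on F a b -> ex_RInt (fun t => Im (F t)) a b.
Proof.
  intros Hab H. apply (ex_RInt_continuous (V := R_CompleteNormedModule)).
  rewrite Rmin_left, Rmax_right by auto. intros t Ht. apply ccont_Im, H, Ht.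
Qed.

Lemma cint_ext (F G : R -> C) (a b : R) :
  a <= b -> (forall t, a <= t <= b -> F t = G t) -> cint F a b = cint G a b.
Proof.
  intros Hab E. unfold cint. f_equal; apply RInt_ext;
    rewrite Rmin_left, Rmax_right by auto; intros t Ht; rewrite E; auto; lra.
Qed.

Lemma cint_Chasles (F : R -> C) (a b c : R) :
  a <= b <= c -> ccont_on F a c -> (cint F a b + cint F b c)%C = cint F a c.
Proof.
  intros Habc H. unfold cint.
  assert (H1 : ccont_on F a b) by (intros t Ht; apply H; lra).
  assert (H2 : ccont_on F b c) by (intros t Ht; apply H; lra).
  apply injective_projections; simpl.
  - apply (RInt_Chasles (V := R_CompleteNormedModule)); apply ccont_on_Re_int; auto; lra.
  - apply (RInt_Chasles (V := R_CompleteNormedModule)); apply ccont_on_Im_int; auto; lra.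
Qed.

Lemma cint_plus (F G : R -> C) (a b : R) :
  a <= b -> ccont_on F a b -> ccont_on G a b ->
  cint (fun t => F t + G t)%C a b = (cint F a b + cint G a b)%C.
Proof.
  intros Hab HF HG. unfold cint. apply injective_projections; simpl.
  - apply (RInt_plus (V := R_CompleteNormedModule)); apply ccont_on_Re_int; auto.
  - apply (RInt_plus (V := R_CompleteNormedModule)); apply ccont_on_Im_int; auto.
Qed.

Lemma cint_scal (c : C) (F : R -> C) (a b : R) :
  a <= b -> ccont_on F a b -> cint (fun t => c * F t)%C a b = (c * cint F a b)%C.
Proof.
  intros Hab HF. unfold cint. destruct c as [c1 c2].
  assert (H1 := ccont_on_Re_int F a b Hab HF).
  assert (H2 := ccont_on_Im_int F a b Hab HF).
  apply injective_projections; simpl; apply is_RInt_unique.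
  - apply (is_RInt_minus (V := R_NormedModule) (fun t => c1 * Re (F t)) (fun t => c2 * Im (F t))).
    + apply (is_RInt_scal (V := R_NormedModule)), (RInt_correct (V := R_CompleteNormedModule)); auto.
    + apply (is_RInt_scal (V := R_NormedModule)), (RInt_correct (V := R_CompleteNormedModule)); auto.
  - apply (is_RInt_plus (V := R_NormedModule) (fun t => c1 * Im (F t)) (fun t => c2 * Re (F t))).
    + apply (is_RInt_scal (V := R_NormedModule)), (RInt_correct (V := R_CompleteNormedModule)); auto.
    + apply (is_RInt_scal (V := R_NormedModule)), (RInt_correct (V := R_CompleteNormedModule)); auto.
Qed.

Lemma cint_minus (F G : R -> C) (a b : R) :
  a <= b -> ccont_on F a b -> ccont_on G a b ->
  cint (fun t => F t - G t)%C a b = (cint F a b - cint G a b)%C.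
Proof.
  intros Hab HF HG.
  assert (HG' : ccont_on (fun t => - (1) * G t)%C a b).
  { intros t Ht. apply ccont_mult; [apply ccont_const|auto]. }
  rewrite (cint_ext _ (fun t => F t + - (1) * G t)%C) by (auto; intros; ring).
  rewrite (cint_plus F (fun t => - (1) * G t)%C), (cint_scal _ G) by auto. ring.
Qed.

Lemma cint_derive (F dF : R -> C) (a b : R) :
  a <= b -> (forall t, a <= t <= b -> rdiff F t (dF t)) -> ccont_on dF a b ->
  cint dF a b = (F b - F a)%C.
Proof.
  intros Hab HF Hc. unfold cint. apply injective_projections; simpl; apply is_RInt_unique.
  - apply (is_RInt_derive (V := R_CompleteNormedModule) (fun t => Re (F t)));
      rewrite Rmin_left, Rmax_right by auto; intros t Ht.
    + apply HF; auto.
    + apply ccont_Re, Hc, Ht.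
  - apply (is_RInt_derive (V := R_CompleteNormedModule) (fun t => Im (F t)));
      rewrite Rmin_left, Rmax_right by auto; intros t Ht.
    + apply HF; auto.
    + apply ccont_Im, Hc, Ht.
Qed.

Lemma cint_bound (F : R -> C) (a b M : R) :
  a <= b -> ccont_on F a b -> (forall t, a <= t <= b -> Cmod (F t) <= M) ->
  Cmod (cint F a b) <= (b - a) * M.
Proof.
  intros Hab HF HM.
  destruct (exists_unit_Re (cint F a b)) as [u [Hu Hu']].
  rewrite <- Hu', <- cint_scal by auto.
  unfold cint, Re at 1; simpl fst.
  assert (Hc : ccont_on (fun t => u * F t)%C a b)
    by (intros t Ht; apply ccont_mult; [apply ccont_const|auto]).
  eapply Rle_trans; [apply Rle_abs|].
  apply (norm_RInt_le_const (V := R_NormedModule) (fun t => Re (u * F t)%C) a b); auto.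
  - intros t Ht. change (Rabs (Re (u * F t)%C) <= M).
    eapply Rle_trans; [apply re_le_Cmod|]. rewrite Cmod_mult, Hu, Rmult_1_l; auto.
  - apply (RInt_correct (V := R_CompleteNormedModule)), (ccont_on_Re_int (fun t => u * F t)%C); auto.
Qed.

(** * Goursat's theorem *)

Lemma nested_intervals (a b : nat -> R) :
  (forall n, a n <= a (S n)) -> (forall n, b (S n) <= b n) -> (forall n, a n <= b n) ->
  exists x, forall n, a n <= x <= b n.
Proof.
  intros Ha Hb Hab.
  assert (Ha' : forall n m, (n <= m)%nat -> a n <= a m).
  { intros n m H; induction H; [lra|]. specialize (Ha m); lra. }
  assert (Hb' : forall n m, (n <= m)%nat -> b m <= b n).
  { intros n m H; induction H; [lra|]. specialize (Hb m); lra. }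
  assert (Hab' : forall n m, a n <= b m).
  { intros n m. specialize (Ha' n (max n m) ltac:(lia)).
    specialize (Hb' m (max n m) ltac:(lia)). specialize (Hab (max n m)). lra. }
  destruct (completeness (fun y => exists n, y = a n)) as [x [Hx1 Hx2]].
  - exists (b O). intros y [n ->]; auto.
  - exists (a O), O; auto.
  - exists x; intros n; split; [apply Hx1; exists n; auto|].
    apply Hx2. intros y [m ->]; auto.
Qed.

Definition half (i : bool) (p : R * R) : R * R :=
  if i then (fst p, (fst p + snd p) / 2) else ((fst p + snd p) / 2, snd p).

Lemma half_spec (i : bool) (p : R * R) : fst p <= snd p ->
  fst p <= fst (half i p) /\ snd (half i p) <= snd p /\
  snd (half i p) - fst (half i p) = (snd p - fst p) / 2.
Proof. destruct i; simpl; lra. Qed.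

Lemma exists_large_quarter (mu : R * R -> R * R -> C) (X Y : R * R) :
  mu X Y = (mu (half true X) (half true Y) + mu (half false X) (half true Y)
            + mu (half true X) (half false Y) + mu (half false X) (half false Y))%C ->
  exists i j, Cmod (mu X Y) / 4 <= Cmod (mu (half i X) (half j Y)).
Proof.
  intros E. apply NNPP; intros N.
  assert (L : forall i j, Cmod (mu (half i X) (half j Y)) < Cmod (mu X Y) / 4).
  { intros i j. apply Rnot_le_lt. intros H; apply N; exists i, j; auto. }
  assert (T := Cmod_triangle (mu (half true X) (half true Y) + mu (half false X) (half true Y)
            + mu (half true X) (half false Y)) (mu (half false X) (half false Y))).
  assert (T2 := Cmod_triangle (mu (half true X) (half true Y) + mu (half false X) (half true Y))
            (mu (half true X) (half false Y))).
  assert (T3 := Cmod_triangle (mu (half true X) (half true Y)) (mu (half false X) (half true Y))).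
  rewrite <- E in T.
  generalize (L true true) (L true false) (L false true) (L false false). lra.
Qed.

(** Testing the quarters one by one makes the subdivision a function, so that the sequence of
    rectangles is a mere iteration. The last quarter is the default: when the first three tests
    fail, it is the large one. *)
Definition quarter (mu : R * R -> R * R -> C) (Q : (R * R) * (R * R)) : (R * R) * (R * R) :=
  let large i j :=
    Rle_dec (Cmod (mu (fst Q) (snd Q)) / 4) (Cmod (mu (half i (fst Q)) (half j (snd Q)))) in
  let sub i j := (half i (fst Q), half j (snd Q)) in
  if large true true then sub true true else
  if large true false then sub true false else
  if large false true then sub false true else sub false false.

Lemma quarter_spec (mu : R * R -> R * R -> C) (X Y : R * R) :
  mu X Y = (mu (half true X) (half true Y) + mu (half false X) (half true Y)
            + mu (half true X) (half false Y) + mu (half false X) (half false Y))%C ->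
  exists i j, quarter mu (X, Y) = (half i X, half j Y) /\
    Cmod (mu X Y) / 4 <= Cmod (mu (half i X) (half j Y)).
Proof.
  intros E. destruct (exists_large_quarter mu X Y E) as [i [j H]].
  unfold quarter; simpl fst; simpl snd.
  repeat (destruct Rle_dec; [eauto|]).
  destruct i, j; try contradiction. eauto.
Qed.

(* Goursat's argument: repeated bisection, always keeping a quarter carrying at
   least a fourth of the value. *)
Lemma additive_rectangle_zero (mu : R * R -> R * R -> C) (A B A' B' : R) :
  A <= B -> A' <= B' ->
  (forall a m b c n d, A <= a <= m -> m <= b <= B -> A' <= c <= n -> n <= d <= B' ->
     mu (a, b) (c, d)
     = (mu (a, m) (c, n) + mu (m, b) (c, n) + mu (a, m) (n, d) + mu (m, b) (n, d))%C) ->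
  (forall x y eps, A <= x <= B -> A' <= y <= B' -> 0 < eps ->
     exists delta, 0 < delta /\ forall a b c d,
       A <= a <= x -> x <= b <= B -> A' <= c <= y -> y <= d <= B' ->
       b - a < delta -> d - c < delta ->
       Cmod (mu (a, b) (c, d)) <= eps * ((b - a) + (d - c)) ^ 2) ->
  mu (A, B) (A', B') = RtoC 0.
Proof.
  intros HAB HAB' Hadd Hsmall.
  set (Q := fun n => Nat.iter n (quarter mu) ((A, B), (A', B'))).
  set (a := fun n => fst (fst (Q n))). set (b := fun n => snd (fst (Q n))).
  set (c := fun n => fst (snd (Q n))). set (d := fun n => snd (snd (Q n))).
  set (m := Cmod (mu (A, B) (A', B'))).
  assert (Inv : forall n, A <= a n <= b n /\ b n <= B /\ A' <= c n <= d n /\ d n <= B' /\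
     b n - a n = (B - A) / 2 ^ n /\ d n - c n = (B' - A') / 2 ^ n /\
     m / 4 ^ n <= Cmod (mu (a n, b n) (c n, d n)) /\
     a n <= a (S n) /\ b (S n) <= b n /\ c n <= c (S n) /\ d (S n) <= d n).
  { assert (Step : forall n, A <= a n <= b n -> b n <= B -> A' <= c n <= d n -> d n <= B' ->
      exists i j, Q (S n) = (half i (a n, b n), half j (c n, d n)) /\
        Cmod (mu (a n, b n) (c n, d n)) / 4
          <= Cmod (mu (half i (a n, b n)) (half j (c n, d n)))).
    { intros n H1 H2 H3 H4.
      replace (Q (S n)) with (quarter mu ((a n, b n), (c n, d n))).
      - apply quarter_spec. apply (Hadd (a n) _ (b n) (c n) _ (d n)); simpl; lra.
      - unfold a, b, c, d. rewrite <- !surjective_pairing. reflexivity. }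
    assert (J : forall n, A <= a n <= b n /\ b n <= B /\ A' <= c n <= d n /\ d n <= B' /\
     b n - a n = (B - A) / 2 ^ n /\ d n - c n = (B' - A') / 2 ^ n /\
     m / 4 ^ n <= Cmod (mu (a n, b n) (c n, d n))).
    { induction n as [|n IH].
      - unfold a, b, c, d, Q, m; simpl. unfold Rdiv; rewrite !Rinv_1, !Rmult_1_r. lra.
      - destruct IH as (H1 & H2 & H3 & H4 & H5 & H6 & H7).
        destruct (Step n H1 H2 H3 H4) as [i [j [E1 E2]]].
        destruct (half_spec i (a n, b n)) as (K1 & K2 & K3); [simpl; lra|].
        destruct (half_spec j (c n, d n)) as (L1 & L2 & L3); [simpl; lra|].
        simpl in K1, K2, L1, L2. simpl (fst (_, _)) in K3, L3. simpl (snd (_, _)) in K3, L3.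
        rewrite H5 in K3. rewrite H6 in L3.
        assert (P : 0 < 2 ^ n) by (apply pow_lt; lra).
        assert (P4 : 0 < 4 ^ n) by (apply pow_lt; lra).
        assert (0 <= (B - A) / 2 ^ n / 2)
          by (apply Rle_div_r; [lra|]; apply Rle_div_r; lra).
        assert (0 <= (B' - A') / 2 ^ n / 2)
          by (apply Rle_div_r; [lra|]; apply Rle_div_r; lra).
        unfold a, b, c, d; rewrite E1; simpl (fst (_, _)); simpl (snd (_, _)).
        replace ((B - A) / 2 ^ S n) with ((B - A) / 2 ^ n / 2) by (simpl; field; lra).
        replace ((B' - A') / 2 ^ S n) with ((B' - A') / 2 ^ n / 2) by (simpl; field; lra).
        replace (m / 4 ^ S n) with (m / 4 ^ n / 4) by (simpl; field; lra).
        rewrite <- !surjective_pairing.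
        repeat split; lra. }
    intros n. destruct (J n) as (H1 & H2 & H3 & H4 & H5 & H6 & H7).
    destruct (Step n H1 H2 H3 H4) as [i [j [E1 _]]].
    destruct (half_spec i (a n, b n)) as (K1 & K2 & _); [simpl; lra|].
    destruct (half_spec j (c n, d n)) as (L1 & L2 & _); [simpl; lra|].
    simpl in K1, K2, L1, L2.
    replace (a (S n)) with (fst (half i (a n, b n))) by (unfold a; rewrite E1; auto).
    replace (b (S n)) with (snd (half i (a n, b n))) by (unfold b; rewrite E1; auto).
    replace (c (S n)) with (fst (half j (c n, d n))) by (unfold c; rewrite E1; auto).
    replace (d (S n)) with (snd (half j (c n, d n))) by (unfold d; rewrite E1; auto).
    repeat split; lra. }
  destruct (nested_intervals a b) as [x Hx]; [apply Inv|apply Inv|apply Inv|].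
  destruct (nested_intervals c d) as [y Hy]; [apply Inv|apply Inv|apply Inv|].
  set (L := (B - A) + (B' - A')).
  assert (HL : 0 <= L) by (unfold L; lra).
  apply Cmod_eq_0, Rle_antisym; [|apply Cmod_ge_0].
  apply le_epsilon; intros e He; rewrite Rplus_0_l. fold m.
  (* [L] is half the perimeter and may be 0 for a degenerate rectangle, hence the added 1 here and
     in [L + 1] below. *)
  destruct (Hsmall x y (e / (L ^ 2 + 1))) as [delta [Hd Hs]].
  - generalize (Hx O) (Inv O); lra.
  - generalize (Hy O) (Inv O); lra.
  - apply Rdiv_lt_0_compat; auto. generalize (pow2_ge_0 L); lra.
  - destruct (pow_lt_1_zero (/ 2) ltac:(rewrite Rabs_pos_eq; lra) (delta / (L + 1)))
      as [N HN]; [apply Rdiv_lt_0_compat; lra|].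
    specialize (HN N (le_n N)).
    assert (P : 0 < 2 ^ N) by (apply pow_lt; lra).
    rewrite pow_inv, Rabs_pos_eq in HN by (apply Rlt_le, Rinv_0_lt_compat; auto).
    apply Rlt_div_r in HN; [|lra].
    destruct (Inv N) as (H1 & H2 & H3 & H4 & H5 & H6 & H7 & _).
    specialize (Hx N). specialize (Hy N).
    assert (Q0 : 0 < / 2 ^ N) by (apply Rinv_0_lt_compat; auto).
    assert (W : L / 2 ^ N < delta) by (unfold Rdiv; lra).
    assert (W1 : (B - A) / 2 ^ N <= L / 2 ^ N)
      by (unfold Rdiv, L; apply Rmult_le_compat_r; lra).
    assert (W2 : (B' - A') / 2 ^ N <= L / 2 ^ N)
      by (unfold Rdiv, L; apply Rmult_le_compat_r; lra).
    specialize (Hs (a N) (b N) (c N) (d N)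
      ltac:(lra) ltac:(lra) ltac:(lra) ltac:(lra) ltac:(lra) ltac:(lra)).
    rewrite H5, H6 in Hs.
    replace ((B - A) / 2 ^ N + (B' - A') / 2 ^ N) with (L / 2 ^ N) in Hs
      by (unfold L; field; lra).
    (* The crux: the upper bound is quadratic in the side lengths and so shrinks like [1 / 4 ^ N],
       exactly as the lower bound [m / 4 ^ N] does. The factor cancels and [m <= e] remains. *)
    assert (F4 : 4 ^ N = 2 ^ N * 2 ^ N) by (rewrite <- Rpow_mult_distr; f_equal; lra).
    assert (G : m / 4 ^ N <= e / (L ^ 2 + 1) * (L / 2 ^ N) ^ 2) by lra.
    rewrite F4 in G.
    apply (Rmult_le_compat_r (2 ^ N * 2 ^ N)) in G;
      [|apply Rlt_le, Rmult_lt_0_compat; auto].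
    replace (m / (2 ^ N * 2 ^ N) * (2 ^ N * 2 ^ N)) with m in G by (field; lra).
    generalize (pow2_ge_0 L); intros HL2.
    replace (e / (L ^ 2 + 1) * (L / 2 ^ N) ^ 2 * (2 ^ N * 2 ^ N))
      with (e * (L ^ 2 / (L ^ 2 + 1))) in G by (field; lra).
    assert (L ^ 2 / (L ^ 2 + 1) <= 1) by (apply Rle_div_l; lra).
    assert (e * (L ^ 2 / (L ^ 2 + 1)) <= e * 1) by (apply Rmult_le_compat_l; lra).
    lra.
Qed.

(* The linear part [l0 + l1 (w - w0)] of [g] has a primitive, so only the
   remainder of [g] at [w0] contributes to the error. *)
Lemma edge_estimate (g : C -> C) (gam dgam : R -> C) (a b e : R) (w0 l0 l1 : C) :
  a <= b ->
  (forall t, a <= t <= b -> rdiff gam t (dgam t)) ->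
  ccont_on dgam a b ->
  ccont_on (fun t => g (gam t)) a b ->
  (forall t, a <= t <= b ->
     Cmod ((g (gam t) - (l0 + l1 * (gam t - w0))) * dgam t) <= e) ->
  Cmod (cint (fun t => g (gam t) * dgam t)%C a b
        - ((l0 * gam b + l1 / 2 * ((gam b - w0) * (gam b - w0)))
           - (l0 * gam a + l1 / 2 * ((gam a - w0) * (gam a - w0)))))
  <= (b - a) * e.
Proof.
  intros Hab Hd Hc Hg He.
  set (H := fun w => (l0 * w + l1 / 2 * ((w - w0) * (w - w0)))%C).
  assert (HH : forall w, cdiff H w (l0 + l1 * (w - w0))).
  { intros w.
    replace (l0 + l1 * (w - w0))%C
      with (l0 * 1 + l1 / 2 * ((1 - 0) * (w - w0) + (w - w0) * (1 - 0)))%C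
      by (field; intros K; apply RtoC_inj in K; lra).
    apply cdiff_plus; apply cdiff_scal; [apply cdiff_id|].
    apply (cdiff_mult (fun w => w - w0)%C (fun w => w - w0)%C);
      apply cdiff_minus; auto using cdiff_id, cdiff_const. }
  assert (Cg : ccont_on gam a b) by (intros t Ht; eapply ccont_rdiff, Hd, Ht).
  set (dH := fun t => ((l0 + l1 * (gam t - w0)) * dgam t)%C).
  assert (CH : ccont_on dH a b).
  { intros t Ht. apply ccont_mult; [|auto]. apply ccont_plus; [apply ccont_const|].
    apply ccont_mult; [apply ccont_const|].
    apply ccont_minus; [auto|apply ccont_const]. }
  assert (E : cint dH a b = (H (gam b) - H (gam a))%C).
  { apply (cint_derive (fun t => H (gam t))); auto.
    intros t Ht. apply rdiff_comp; auto. }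
  fold (H (gam a)) (H (gam b)). rewrite <- E.
  rewrite <- cint_minus; auto.
  - apply cint_bound; auto.
    + intros t Ht.
      apply ccont_minus; [apply ccont_mult|]; auto.
    + intros t Ht. unfold dH.
      replace (g (gam t) * dgam t - (l0 + l1 * (gam t - w0)) * dgam t)%C
        with ((g (gam t) - (l0 + l1 * (gam t - w0))) * dgam t)%C by ring. auto.
  - intros t Ht. apply ccont_mult; auto.
Qed.

Lemma lipschitz_of_rdiff_bound (F dF : R -> C) (a b L x y : R) :
  (forall t, a <= t <= b -> rdiff F t (dF t)) ->
  (forall t, a <= t <= b -> Cmod (dF t) <= L) ->
  a <= x <= b -> a <= y <= b -> Cmod (F y - F x) <= L * Rabs (y - x).
Proof.
  intros HF HL.
  assert (K : forall x y, a <= x <= b -> a <= y <= b -> x <= y ->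
                Cmod (F y - F x) <= L * (y - x)).
  { intros u v Hu Hv Huv.
    rewrite Rmult_minus_distr_l.
    apply (mean_value_inequality F dF (fun t => L * t) (fun _ => L)); auto.
    - intros; apply HF; lra.
    - intros; auto_derive; auto; ring.
    - intros; apply HL; lra. }
  intros Hx Hy. destruct (Rle_dec x y).
  - rewrite Rabs_pos_eq by lra. auto.
  - rewrite Cmod_sub_sym, Rabs_left1 by lra.
    replace (L * - (y - x)) with (L * (x - y)) by ring. apply K; auto; lra.
Qed.

(* Bisecting the parameter rectangle rather than its image spares the passage
   from rectangles to homotopies. *)
Theorem goursat_parametric (g : C -> C) (Phi Phi1 Phi2 : R -> R -> C) (A B A' B' L : R) :
  A <= B -> A' <= B' ->
  (forall t s, A <= t <= B -> A' <= s <= B' ->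
     rdiff (fun t => Phi t s) t (Phi1 t s) /\ rdiff (Phi t) s (Phi2 t s) /\
     ccont (fun t => Phi1 t s) t /\ ccont (Phi2 t) s /\
     Cmod (Phi1 t s) <= L /\ Cmod (Phi2 t s) <= L /\
     exists l, cdiff g (Phi t s) l) ->
  (cint (fun t => g (Phi t A') * Phi1 t A')%C A B
   + cint (fun s => g (Phi B s) * Phi2 B s)%C A' B')%C
  = (cint (fun t => g (Phi t B') * Phi1 t B')%C A B
   + cint (fun s => g (Phi A s) * Phi2 A s)%C A' B')%C.
Proof.
  intros HAB HAB' H.
  assert (HL : 0 <= L).
  { destruct (H A A') as (_ & _ & _ & _ & K & _); try lra.
    eapply Rle_trans; [apply Cmod_ge_0|exact K]. }
  set (I1 := fun s a b => cint (fun t => g (Phi t s) * Phi1 t s)%C a b).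
  set (I2 := fun t c d => cint (fun s => g (Phi t s) * Phi2 t s)%C c d).
  (* The integral of [g] along the image of the boundary: lower and right edges minus upper and left
     edges. It is additive because an edge shared by two pieces is run through in both
     directions. *)
  set (mu := fun (X Y : R * R) =>
    ((I1 (fst Y) (fst X) (snd X) + I2 (snd X) (fst Y) (snd Y))
     - (I1 (snd Y) (fst X) (snd X) + I2 (fst X) (fst Y) (snd Y)))%C).
  assert (Cg1 : forall t s, A <= t <= B -> A' <= s <= B' -> ccont (fun t => g (Phi t s)) t).
  { intros t s Ht Hs. destruct (H t s Ht Hs) as (K1 & K2 & _ & _ & _ & _ & [l Kl]).
    apply (ccont_comp g (fun t => Phi t s) t l Kl). eapply ccont_rdiff, K1. }
  assert (Cg2 : forall t s, A <= t <= B -> A' <= s <= B' -> ccont (fun s => g (Phi t s)) s).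
  { intros t s Ht Hs. destruct (H t s Ht Hs) as (K1 & K2 & _ & _ & _ & _ & [l Kl]).
    apply (ccont_comp g (Phi t) s l Kl). eapply ccont_rdiff, K2. }
  assert (C1 : forall s a b, A' <= s <= B' -> A <= a -> b <= B ->
    ccont_on (fun t => g (Phi t s) * Phi1 t s)%C a b).
  { intros s a b Hs Ha Hb t Ht. apply ccont_mult; [apply Cg1; auto; lra|].
    apply H; auto; lra. }
  assert (C2 : forall t c d, A <= t <= B -> A' <= c -> d <= B' ->
    ccont_on (fun s => g (Phi t s) * Phi2 t s)%C c d).
  { intros t c d Ht Hc Hd s Hs. apply ccont_mult; [apply Cg2; auto; lra|].
    apply H; auto; lra. }
  assert (Z : mu (A, B) (A', B') = RtoC 0).
  { apply additive_rectangle_zero; auto.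
    - intros a m b c n d H1 H2 H3 H4. unfold mu; simpl fst; simpl snd.
      assert (E1 : forall s, A' <= s <= B' -> I1 s a b = (I1 s a m + I1 s m b)%C).
      { intros s Hs. symmetry. apply cint_Chasles; [lra|]. apply C1; lra. }
      assert (E2 : forall t, A <= t <= B -> I2 t c d = (I2 t c n + I2 t n d)%C).
      { intros t Ht. symmetry. apply cint_Chasles; [lra|]. apply C2; lra. }
      rewrite (E1 c), (E1 d), (E2 a), (E2 b) by lra. ring.
    - intros x y eps Hx Hy He.
      destruct (H x y Hx Hy) as (_ & _ & _ & _ & _ & _ & [l Hl]).
      set (w0 := Phi x y) in *.
      (* One factor [L + 1] pays for the distance [(L + 1) * p] of the image from [w0], the other
         for the speed of the edges. The four edges have total length [2 * p], which the factor 2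
         absorbs. *)
      set (e := eps / (2 * (L + 1) * (L + 1))).
      assert (Pe : 0 < e).
      { apply Rdiv_lt_0_compat; auto. repeat apply Rmult_lt_0_compat; lra. }
      destruct (Hl e Pe) as [d0 [Hd0 Kd]].
      exists (d0 / (2 * (L + 1))); split; [apply Rdiv_lt_0_compat; lra|].
      intros a b c d Ha Hb Hc Hd Hab Hcd.
      set (p := (b - a) + (d - c)).
      assert (Hp : 0 <= p) by (unfold p; lra).
      assert (Hp' : (L + 1) * p < d0).
      { assert (p < d0 / (2 * (L + 1)) * 2) by (unfold p; lra).
        apply Rmult_lt_reg_l with (/ (L + 1)); [apply Rinv_0_lt_compat; lra|].
        rewrite <- Rmult_assoc, Rinv_l, Rmult_1_l by lra.
        replace (/ (L + 1) * d0) with (d0 / (2 * (L + 1)) * 2) by (field; lra). auto. }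
      assert (Near : forall t s, a <= t <= b -> c <= s <= d ->
                Cmod (Phi t s - w0) <= (L + 1) * p).
      { intros t s Ht Hs.
        eapply Rle_trans; [apply (Cmod_sub_triangle _ (Phi x s))|].
        assert (N1 : Cmod (Phi t s - Phi x s) <= L * Rabs (t - x)).
        { apply (lipschitz_of_rdiff_bound (fun t => Phi t s) (fun t => Phi1 t s) A B); try lra;
            intros u Hu; apply (H u s); auto; lra. }
        assert (N2 : Cmod (Phi x s - w0) <= L * Rabs (s - y)).
        { apply (lipschitz_of_rdiff_bound (Phi x) (Phi2 x) A' B'); try lra;
            intros u Hu; apply (H x u); auto; lra. }
        assert (Rabs (t - x) <= b - a) by (apply Rabs_le; lra).
        assert (Rabs (s - y) <= d - c) by (apply Rabs_le; lra).
        assert (L * Rabs (t - x) <= L * (b - a)) by (apply Rmult_le_compat_l; auto).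
        assert (L * Rabs (s - y) <= L * (d - c)) by (apply Rmult_le_compat_l; auto).
        assert (L * (b - a) + L * (d - c) = L * p) by (unfold p; ring). lra. }
      assert (Err : forall t s v, a <= t <= b -> c <= s <= d -> Cmod v <= L ->
        Cmod ((g (Phi t s) - (g w0 + l * (Phi t s - w0))) * v) <= eps / 2 * p).
      { intros t s v Ht Hs Hv. rewrite Cmod_mult.
        specialize (Near t s Ht Hs).
        assert (Kd' := Kd (Phi t s) ltac:(lra)).
        replace (g (Phi t s) - g w0 - l * (Phi t s - w0))%C
          with (g (Phi t s) - (g w0 + l * (Phi t s - w0)))%C in Kd' by ring.
        apply Rle_trans with (e * ((L + 1) * p) * (L + 1)).
        - apply Rmult_le_compat; auto using Cmod_ge_0; [|lra].
          eapply Rle_trans; [exact Kd'|]. apply Rmult_le_compat_l; lra.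
        - apply Req_le. unfold e. field; lra. }
      set (Hq := fun w => (g w0 * w + l / 2 * ((w - w0) * (w - w0)))%C).
      assert (X1 : forall s, c <= s <= d ->
        Cmod (I1 s a b - (Hq (Phi b s) - Hq (Phi a s))) <= (b - a) * (eps / 2 * p)).
      { intros s Hs. apply (edge_estimate g (fun t => Phi t s) (fun t => Phi1 t s)); try lra.
        - intros t Ht; apply H; lra.
        - intros t Ht; apply H; lra.
        - intros t Ht; apply Cg1; lra.
        - intros t Ht; apply Err; auto. apply H; lra. }
      assert (X2 : forall t, a <= t <= b ->
        Cmod (I2 t c d - (Hq (Phi t d) - Hq (Phi t c))) <= (d - c) * (eps / 2 * p)).
      { intros t Ht. apply (edge_estimate g (Phi t) (Phi2 t)); try lra.
        - intros s Hs; apply H; lra.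
        - intros s Hs; apply H; lra.
        - intros s Hs; apply Cg2; lra.
        - intros s Hs; apply Err; auto. apply H; lra. }
      assert (Y1 := X1 c ltac:(lra)). assert (Y2 := X1 d ltac:(lra)).
      assert (Y3 := X2 a ltac:(lra)). assert (Y4 := X2 b ltac:(lra)).
      unfold mu; simpl fst; simpl snd.
      (* The corner values of the primitive [Hq] cancel around the closed contour, so they may be
         inserted edge by edge. *)
      replace (I1 c a b + I2 b c d - (I1 d a b + I2 a c d))%C
        with (((I1 c a b - (Hq (Phi b c) - Hq (Phi a c)))
               + (I2 b c d - (Hq (Phi b d) - Hq (Phi b c))))
              - ((I1 d a b - (Hq (Phi b d) - Hq (Phi a d)))
               + (I2 a c d - (Hq (Phi a d) - Hq (Phi a c)))))%C by ring.
      eapply Rle_trans; [apply Cmod_triangle_minus|].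
      eapply Rle_trans; [apply Rplus_le_compat; apply Cmod_triangle|].
      apply Rle_trans with (2 * ((b - a) * (eps / 2 * p)) + 2 * ((d - c) * (eps / 2 * p)));
        [lra|].
      apply Req_le. unfold p. field. }
  unfold mu in Z; simpl fst in Z; simpl snd in Z.
  fold (I1 A' A B) (I1 B' A B) (I2 A A' B') (I2 B A' B').
  match goal with |- ?x = ?y => replace x with ((x - y) + y)%C by ring; rewrite Z; ring end.
Qed.

(** * Cauchy's formula *)

Definition circ (c : C) (r theta : R) : C := (c + polar r theta)%C.
Definition dcirc (r theta : R) : C := (Ci * polar r theta)%C.

Lemma rdiff_circ (c : C) (r theta : R) : rdiff (circ c r) theta (dcirc r theta).
Proof.
  destruct c; split; unfold circ, dcirc, polar, Ci; simpl; auto_derive; auto; ring.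
Qed.

Lemma rdiff_dcirc (r theta : R) : rdiff (dcirc r) theta (- polar r theta).
Proof. split; unfold dcirc, polar, Ci; simpl; auto_derive; auto; ring. Qed.

Lemma polar_2PI (r : R) : polar r (2 * PI) = polar r 0.
Proof. unfold polar. rewrite cos_2PI, sin_2PI, cos_0, sin_0. reflexivity. Qed.

Lemma Cmod_dcirc (r theta : R) : 0 < r -> Cmod (dcirc r theta) = r.
Proof.
  intros Hr. unfold dcirc. rewrite Cmod_mult, Cmod_Ci, Cmod_polar, Rabs_pos_eq; lra.
Qed.

Lemma circ_dist_center (c : C) (r theta : R) : 0 < r -> Cmod (circ c r theta - c) = r.
Proof.
  intros Hr. unfold circ. replace (c + polar r theta - c)%C with (polar r theta) by ring.
  rewrite Cmod_polar, Rabs_pos_eq; lra.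
Qed.

Lemma circ_dist_ge (c z : C) (r theta : R) :
  0 < r -> r - Cmod (z - c) <= Cmod (circ c r theta - z).
Proof.
  intros Hr. generalize (Cmod_sub_triangle (circ c r theta) z c).
  rewrite circ_dist_center; lra.
Qed.

Lemma circ_neq (c z : C) (r theta : R) :
  Cmod (z - c) < r -> (circ c r theta - z)%C <> RtoC 0.
Proof.
  intros H. apply Cmod_gt_0.
  generalize (Cmod_ge_0 (z - c)); intros.
  generalize (circ_dist_ge c z r theta ltac:(lra)); lra.
Qed.

Lemma cdiff_shift (f : C -> C) (a z l : C) :
  cdiff f (z - a) l -> cdiff (fun w => f (w - a)%C) z l.
Proof.
  intros H eps He. destruct (H eps He) as [d [Hd K]]. exists d; split; auto.
  intros w Hw. specialize (K (w - a)%C).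
  replace (w - a - (z - a))%C with (w - z)%C in K by ring. auto.
Qed.

Lemma cdiff_inv_shift (a z : C) :
  (z - a)%C <> RtoC 0 -> cdiff (fun w => / (w - a))%C z (- / ((z - a) * (z - a))).
Proof. intros H. apply (cdiff_shift Cinv), cdiff_inv, H. Qed.

Lemma ccont_inv_circ (c z : C) (r theta : R) :
  Cmod (z - c) < r -> ccont (fun t => / (circ c r t - z))%C theta.
Proof.
  intros H. eapply (ccont_comp (fun w => / (w - z))%C (circ c r)).
  - apply cdiff_inv_shift, circ_neq, H.
  - eapply ccont_rdiff, rdiff_circ.
Qed.

Lemma ccont_dcirc (r theta : R) : ccont (dcirc r) theta.
Proof. eapply ccont_rdiff, rdiff_dcirc. Qed.

Lemma PI2_pos : 0 <= 2 * PI.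
Proof. generalize PI_RGT_0; lra. Qed.

(* The homotopy [z + t (circ - z)], [eps <= t <= 1], contracts the circle
   towards [z], where the difference quotient stays bounded. *)
Lemma cauchy_difference_quotient (f : C -> C) (c z : C) (r R0 : R) :
  (forall w, Cmod (w - c) < R0 -> exists l, cdiff f w l) ->
  0 < r < R0 -> Cmod (z - c) < r ->
  cint (fun t => (f (circ c r t) - f z) * / (circ c r t - z) * dcirc r t)%C 0 (2 * PI)
  = RtoC 0.
Proof.
  intros Hf Hr Hz.
  set (g := fun w => ((f w - f z) * / (w - z))%C).
  assert (Hg : forall w, Cmod (w - c) < R0 -> w <> z -> exists l, cdiff g w l).
  { intros w Hw Hwz. destruct (Hf w Hw) as [l Hl].
    eexists. apply (cdiff_mult (fun w => f w - f z)%C (fun w => / (w - z))%C).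
    - apply cdiff_minus; [exact Hl|apply cdiff_const].
    - apply cdiff_inv_shift. intros E; apply Hwz.
      replace w with ((w - z) + z)%C by ring. rewrite E; ring. }
  set (Phi := fun t s => (z + RtoC t * (circ c r s - z))%C).
  set (Phi1 := fun (t s : R) => (circ c r s - z)%C).
  set (Phi2 := fun t s => (RtoC t * dcirc r s)%C).
  assert (Hz0 := Cmod_ge_0 (z - c)).
  assert (Hup : forall s, Cmod (circ c r s - z) <= 2 * r).
  { intros s. eapply Rle_trans; [apply (Cmod_sub_triangle _ c)|].
    rewrite circ_dist_center, (Cmod_sub_sym c z) by lra. lra. }
  assert (Pdisc : forall t s, 0 <= t <= 1 -> Cmod (Phi t s - c) <= r).
  { intros t s Ht.
    replace (Phi t s - c)%C
      with (RtoC (1 - t) * (z - c) + RtoC t * (circ c r s - c))%C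
      by (unfold Phi; rewrite RtoC_minus; ring).
    eapply Rle_trans; [apply Cmod_triangle|].
    rewrite !Cmod_mult, !Cmod_R, circ_dist_center, !Rabs_pos_eq by lra.
    assert ((1 - t) * Cmod (z - c) <= (1 - t) * r)
      by (apply Rmult_le_compat_l; lra). lra. }
  (* The contraction stops at a positive parameter because [Hg] gives differentiability of the
     quotient only away from [z]. *)
  assert (J : forall e, 0 < e <= 1 ->
    cint (fun s => g (Phi 1 s) * Phi2 1 s)%C 0 (2 * PI)
    = cint (fun s => g (Phi e s) * Phi2 e s)%C 0 (2 * PI)).
  { intros e He.
    assert (G := goursat_parametric g Phi Phi1 Phi2 e 1 0 (2 * PI) (2 * r)
                   ltac:(lra) PI2_pos).
    (* The circle closes up, so the edges at angles [0] and [2 * PI] have the same image and their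
       integrals drop out of Goursat's identity, leaving the two loops. *)
    assert (E0 : forall t, Phi t (2 * PI) = Phi t 0)
      by (intros t; unfold Phi, circ; rewrite polar_2PI; auto).
    assert (E1 : forall t, Phi1 t (2 * PI) = Phi1 t 0)
      by (intros t; unfold Phi1, circ; rewrite polar_2PI; auto).
    rewrite (cint_ext (fun t => g (Phi t (2 * PI)%R) * Phi1 t (2 * PI)%R)%C
                      (fun t => g (Phi t 0) * Phi1 t 0)%C e 1) in G
      by (try lra; intros; rewrite E0, E1; auto).
    match type of G with _ -> ?P => assert (G' : P) end.
    { apply G. intros t s Ht Hs.
      refine (conj _ (conj _ (conj _ (conj _ (conj _ (conj _ _)))))).
      - apply rdiff_line.
      - unfold Phi, circ, Phi2, dcirc, polar, Ci, RtoC. destruct z, c.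
        split; simpl; auto_derive; auto; ring.
      - exact (ccont_const (circ c r s - z)%C t).
      - apply (ccont_mult (fun _ => RtoC t) (dcirc r)); [apply ccont_const|apply ccont_dcirc].
      - apply Hup.
      - unfold Phi2. rewrite Cmod_mult, Cmod_R, Rabs_pos_eq, Cmod_dcirc by lra.
        apply Rmult_le_compat_r; lra.
      - apply Hg.
        + generalize (Pdisc t s ltac:(lra)); lra.
        + intros E. assert (K : (RtoC t * (circ c r s - z))%C = RtoC 0).
          { replace (RtoC t * (circ c r s - z))%C with (Phi t s - z)%C by (unfold Phi; ring).
            rewrite E; ring. }
          apply Cmult_neq_0 in K; auto; [|apply circ_neq, Hz].
          intros K'; apply RtoC_inj in K'; lra. }
    match type of G' with (?a + ?b)%C = (?a + ?d)%C =>
      replace b with ((a + b) - a)%C by ring; rewrite G'; ring end. }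
  transitivity (cint (fun s => g (Phi 1 s) * Phi2 1 s)%C 0 (2 * PI)).
  { apply cint_ext; [apply PI2_pos|]. intros s _. unfold g, Phi, Phi2.
    replace (z + 1 * (circ c r s - z))%C with (circ c r s) by ring. ring. }
  apply C_eq_of_small. intros e He.
  destruct (Hf z ltac:(lra)) as [l Hl].
  destruct (cdiff_lipschitz f z l Hl) as [d [Hd Kd]].
  set (B := Cmod l + 1). assert (HB : 0 < B) by (generalize (Cmod_ge_0 l); unfold B; lra).
  assert (HPI := PI_RGT_0).
  (* The bound [d / (4 * r)] puts the contracted circle, of points at distance at most [2 * r * x]
     from [z], where the quotient is at most [B]. The bound by [e] then controls length times
     [B]. *)
  set (x := Rmin 1 (Rmin (d / (4 * r)) (e / (2 * PI * (B * r))))).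
  assert (PB : 0 < 2 * PI * (B * r)) by (apply Rmult_lt_0_compat; [|apply Rmult_lt_0_compat]; lra).
  assert (Hx : 0 < x).
  { unfold x; repeat apply Rmin_glb_lt; try lra; apply Rdiv_lt_0_compat; lra. }
  assert (x1 : x <= 1) by apply Rmin_l.
  assert (x2 : x <= d / (4 * r)) by (eapply Rle_trans; [apply Rmin_r|apply Rmin_l]).
  assert (x3 : x <= e / (2 * PI * (B * r))) by (eapply Rle_trans; [apply Rmin_r|apply Rmin_r]).
  apply Rle_div_r in x2; [|lra]. apply Rle_div_r in x3; [|lra].
  replace (cint (fun s => g (Phi 1 s) * Phi2 1 s)%C 0 (2 * PI) - 0)%C
    with (cint (fun s => g (Phi 1 s) * Phi2 1 s)%C 0 (2 * PI)) by ring.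
  rewrite (J x) by lra.
  apply Rle_trans with ((2 * PI - 0) * (B * (x * r))); [|lra].
  assert (Pz : forall s, (Phi x s - z)%C = (RtoC x * (circ c r s - z))%C)
    by (intros; unfold Phi; ring).
  assert (Pn : forall s, (Phi x s - z)%C <> RtoC 0).
  { intros s. rewrite Pz. apply Cmult_neq_0; [|apply circ_neq, Hz].
    intros K; apply RtoC_inj in K; lra. }
  assert (Pd : forall s, Cmod (Phi x s - z) <= x * (2 * r)).
  { intros s. rewrite Pz, Cmod_mult, Cmod_R, Rabs_pos_eq by lra.
    apply Rmult_le_compat_l; [lra|apply Hup]. }
  apply cint_bound; [apply PI2_pos| |].
  - intros s Hs. apply ccont_mult.
    + destruct (Hg (Phi x s)) as [m Hm].
      * generalize (Pdisc x s ltac:(lra)); lra.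
      * intros E; apply (Pn s); rewrite E; ring.
      * eapply (ccont_comp g (Phi x)); [exact Hm|].
        apply ccont_plus; [apply ccont_const|]. apply ccont_mult; [apply ccont_const|].
        apply ccont_minus; [|apply ccont_const]. eapply ccont_rdiff, rdiff_circ.
    + apply (ccont_mult (fun _ => RtoC x) (dcirc r)); [apply ccont_const|apply ccont_dcirc].
  - intros s Hs. unfold g, Phi2. rewrite !Cmod_mult, Cmod_inv, Cmod_R, Cmod_dcirc, (Rabs_pos_eq x)
      by (auto; lra).
    apply Rmult_le_compat_r; [apply Rmult_le_pos; lra|].
    assert (0 < Cmod (Phi x s - z)) by (apply Cmod_gt_0, Pn).
    apply Rle_div_l; auto. apply Kd.
    specialize (Pd s). assert (x * (2 * r) < d); lra.
Qed.

(* To be used with [u = 1/(x-h)] and [v = 1/x]. *)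
Lemma resolvent_pow_remainder (m : nat) (b : R) : exists K, 0 <= K /\
  forall u v h : C, Cmod u <= b -> Cmod v <= b -> (u - v)%C = (h * (u * v))%C ->
    Cmod (u ^ m - v ^ m - RtoC (INR m) * v ^ S m * h) <= K * Cmod h ^ 2.
Proof.
  destruct (Rle_dec 0 b) as [Hb|Hb].
  2:{ exists 0; split; [lra|]. intros u v h Hu. generalize (Cmod_ge_0 u); lra. }
  induction m as [|m [K [HK IH]]].
  - exists 0; split; [lra|]. intros u v h _ _ _.
    replace (u ^ 0 - v ^ 0 - RtoC (INR 0) * v ^ 1 * h)%C with (RtoC 0)
      by (simpl; ring). rewrite Cmod_0; lra.
  - exists (b * K + INR m * b ^ S m * b ^ 2 + b ^ m * b ^ 3).
    assert (P : forall n, 0 <= b ^ n) by (intros; apply pow_le; auto).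
    split.
    { assert (0 <= b * K) by (apply Rmult_le_pos; auto).
      assert (0 <= INR m * b ^ S m * b ^ 2)
        by (apply Rmult_le_pos; [apply Rmult_le_pos|]; auto; apply pos_INR).
      assert (0 <= b ^ m * b ^ 3) by (apply Rmult_le_pos; auto). lra. }
    intros u v h Hu Hv E. specialize (IH u v h Hu Hv E).
    (* In this polynomial identity the last summand vanishes by the relation between [u] and [v].
       The first carries the induction hypothesis; in the two others [u - v] is [h * (u * v)], which
       supplies the second factor [h]. *)
    replace (u ^ S m - v ^ S m - RtoC (INR (S m)) * v ^ S (S m) * h)%C
      with (u * (u ^ m - v ^ m - RtoC (INR m) * v ^ S m * h)
            + RtoC (INR m) * v ^ S m * h * (u - v)
            + v ^ m * (h * v * (u - v))
            + v ^ m * (u - v - h * (u * v)))%C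
      by (rewrite S_INR, RtoC_plus, !Cpow_S; ring).
    rewrite E. replace (h * (u * v) - h * (u * v))%C with (RtoC 0) by ring.
    rewrite Cmult_0_r, Cplus_0_r.
    eapply Rle_trans; [apply Cmod_triangle|].
    eapply Rle_trans; [apply Rplus_le_compat_r, Cmod_triangle|].
    rewrite !Cmod_mult, !Cmod_pow, Cmod_R, (Rabs_pos_eq (INR m)) by apply pos_INR.
    set (x := Cmod h) in *. assert (Hx : 0 <= x) by apply Cmod_ge_0.
    assert (Hx2 : 0 <= x ^ 2) by apply pow2_ge_0.
    assert (Hu0 := Cmod_ge_0 u). assert (Hv0 := Cmod_ge_0 v).
    assert (T1 : Cmod u * Cmod (u ^ m - v ^ m - RtoC (INR m) * v ^ S m * h) <= b * (K * x ^ 2))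
      by (apply Rmult_le_compat; auto using Cmod_ge_0).
    assert (Q : Cmod u * Cmod v <= b * b) by (apply Rmult_le_compat; auto).
    assert (Q0 : 0 <= Cmod u * Cmod v) by (apply Rmult_le_pos; auto).
    assert (T2 : INR m * Cmod v ^ S m * x * (x * (Cmod u * Cmod v))
                 <= INR m * b ^ S m * b ^ 2 * x ^ 2).
    { replace (INR m * Cmod v ^ S m * x * (x * (Cmod u * Cmod v)))
        with ((INR m * Cmod v ^ S m) * (Cmod u * Cmod v) * x ^ 2) by ring.
      apply Rmult_le_compat_r; auto.
      replace (b ^ 2) with (b * b) by ring.
      apply Rmult_le_compat; auto.
      - apply Rmult_le_pos; [apply pos_INR|apply pow_le; auto].
      - apply Rmult_le_compat_l; [apply pos_INR|apply pow_incr; auto]. }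
    assert (T3 : Cmod v ^ m * (x * Cmod v * (x * (Cmod u * Cmod v))) <= b ^ m * b ^ 3 * x ^ 2).
    { replace (Cmod v ^ m * (x * Cmod v * (x * (Cmod u * Cmod v))))
        with (Cmod v ^ m * (Cmod v * (Cmod u * Cmod v)) * x ^ 2) by ring.
      apply Rmult_le_compat_r; auto.
      replace (b ^ 3) with (b * (b * b)) by ring.
      apply Rmult_le_compat.
      - apply pow_le; auto.
      - apply Rmult_le_pos; auto.
      - apply pow_incr; auto.
      - apply Rmult_le_compat; auto. }
    lra.
Qed.

(** A Cauchy integral with a general density, which contains the speed of the circle but not the
    constant [1 / (2 i PI)]. The density [dcirc r] gives the winding number, [f * dcirc r] gives [f]
    for [m = 1] and, up to a factor, its derivatives for larger [m]. *)
Definition cauchy_transform (c : C) (r : R) (phi : R -> C) (m : nat) (z : C) : C :=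
  cint (fun t => phi t * (/ (circ c r t - z)) ^ m)%C 0 (2 * PI).

Lemma ccont_on_cauchy_kernel (c : C) (r : R) (phi : R -> C) (m : nat) (z : C) :
  ccont_on phi 0 (2 * PI) -> Cmod (z - c) < r ->
  ccont_on (fun t => phi t * (/ (circ c r t - z)) ^ m)%C 0 (2 * PI).
Proof.
  intros Hphi Hz t Ht. apply ccont_mult; auto.
  apply ccont_pow, ccont_inv_circ, Hz.
Qed.

(** Differentiation under the integral sign: the kernel has a quadratic remainder uniform along the
    circle, so integrating against a bounded density keeps it quadratic. *)
Lemma cauchy_transform_derive (c : C) (r B : R) (phi : R -> C) (m : nat) (z : C) :
  ccont_on phi 0 (2 * PI) -> (forall t, 0 <= t <= 2 * PI -> Cmod (phi t) <= B) ->
  Cmod (z - c) < r ->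
  cdiff (cauchy_transform c r phi m) z
    (RtoC (INR m) * cauchy_transform c r phi (S m) z).
Proof.
  intros Hphi HB Hz.
  set (rho := r - Cmod (z - c)). assert (Hrho : 0 < rho) by (unfold rho; lra).
  assert (Hr : 0 < r) by (generalize (Cmod_ge_0 (z - c)); lra).
  assert (HB0 : 0 <= B).
  { eapply Rle_trans; [apply Cmod_ge_0|]. apply (HB 0). split; [lra|apply PI2_pos]. }
  (* [rho] is a lower bound for the distance from [z] to the circle; for [w] within [rho / 2] of [z]
     both kernels are at most [2 / rho]. *)
  destruct (resolvent_pow_remainder m (2 / rho)) as [K [HK Hrem]].
  assert (HPI := PI_RGT_0).
  set (A := 2 * PI * (B * K)).
  assert (HA : 0 <= A).
  { unfold A. apply Rmult_le_pos; [lra|]. apply Rmult_le_pos; auto. }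
  intros eps He.
  exists (Rmin (rho / 2) (eps / (A + 1))); split.
  { apply Rmin_glb_lt; [lra|apply Rdiv_lt_0_compat; lra]. }
  intros w Hw. set (h := (w - z)%C) in *.
  assert (H1 : Cmod h < rho / 2) by (eapply Rlt_le_trans; [exact Hw|apply Rmin_l]).
  assert (H2 : Cmod h < eps / (A + 1)) by (eapply Rlt_le_trans; [exact Hw|apply Rmin_r]).
  apply Rlt_div_r in H2; [|lra].
  assert (Hh := Cmod_ge_0 h).
  assert (Hwc : Cmod (w - c) < r - rho / 2).
  { eapply Rle_lt_trans; [apply (Cmod_sub_triangle _ z)|]. fold h. unfold rho in *; lra. }
  assert (C1 := ccont_on_cauchy_kernel c r phi m w Hphi ltac:(lra)).
  assert (C2 := ccont_on_cauchy_kernel c r phi m z Hphi Hz).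
  assert (C3 := ccont_on_cauchy_kernel c r phi (S m) z Hphi Hz).
  assert (P2 := PI2_pos).
  replace (cauchy_transform c r phi m w - cauchy_transform c r phi m z
           - RtoC (INR m) * cauchy_transform c r phi (S m) z * h)%C
    with (cauchy_transform c r phi m w - cauchy_transform c r phi m z
           - (RtoC (INR m) * h) * cauchy_transform c r phi (S m) z)%C by ring.
  unfold cauchy_transform.
  rewrite <- cint_scal, <- cint_minus, <- cint_minus; auto.
  2:{ intros t Ht. apply ccont_minus; auto. }
  2:{ intros t Ht. apply ccont_mult; [apply ccont_const|auto]. }
  apply Rle_trans with ((2 * PI - 0) * (B * (K * Cmod h ^ 2))).
  - apply cint_bound; auto.
    + intros t Ht. apply ccont_minus; [apply ccont_minus; auto|].
      apply ccont_mult; [apply ccont_const|auto].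
    + intros t Ht.
      set (u := (/ (circ c r t - w))%C). set (v := (/ (circ c r t - z))%C).
      replace (phi t * u ^ m - phi t * v ^ m - RtoC (INR m) * h * (phi t * v ^ S m))%C
        with (phi t * (u ^ m - v ^ m - RtoC (INR m) * v ^ S m * h))%C by ring.
      rewrite Cmod_mult. apply Rmult_le_compat; auto using Cmod_ge_0.
      assert (Nw : (circ c r t - w)%C <> RtoC 0) by (apply circ_neq; lra).
      assert (Nz : (circ c r t - z)%C <> RtoC 0) by (apply circ_neq; lra).
      assert (Dw := circ_dist_ge c w r t Hr). assert (Dz := circ_dist_ge c z r t Hr).
      replace (2 / rho) with (/ (rho / 2)) in Hrem by (field; lra).
      apply Hrem.
      * unfold u. rewrite Cmod_inv by auto. apply Rinv_le_contravar; lra.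
      * unfold v. rewrite Cmod_inv by auto. apply Rinv_le_contravar; [lra|].
        fold rho in Dz. lra.
      * unfold u, v, h. field; auto.
  - replace ((2 * PI - 0) * (B * (K * Cmod h ^ 2))) with (A * Cmod h * Cmod h)
      by (unfold A; ring).
    apply Rmult_le_compat_r; auto. lra.
Qed.

(** For exponent 2 the integrand is, up to sign, the derivative of [1 / (circ - z)] along a closed
    curve, so the integral vanishes. The integral for exponent 1 therefore has derivative 0 in [z]
    and keeps the value it has at the centre, where the integrand is the constant [Ci]. *)
Lemma winding_number (c z : C) (r : R) :
  Cmod (z - c) < r -> cauchy_transform c r (dcirc r) 1 z = (Ci * RtoC (2 * PI))%C.
Proof.
  intros Hz. assert (P2 := PI2_pos).
  assert (Hr : 0 < r) by (generalize (Cmod_ge_0 (z - c)); lra).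
  assert (Cd : ccont_on (dcirc r) 0 (2 * PI)) by (intros t _; apply ccont_dcirc).
  assert (Z2 : forall w, Cmod (w - c) < r -> cauchy_transform c r (dcirc r) 2 w = RtoC 0).
  { intros w Hw. unfold cauchy_transform.
    set (F := fun t => (/ (circ c r t - w))%C).
    set (dF := fun t => (- / ((circ c r t - w) * (circ c r t - w)) * dcirc r t)%C).
    assert (N : forall t, (circ c r t - w)%C <> RtoC 0) by (intros; apply circ_neq, Hw).
    assert (EF : forall t, dF t = (- (1) * (dcirc r t * (/ (circ c r t - w)) ^ 2))%C).
    { intros t. unfold dF. simpl. field; auto. }
    assert (Ck := ccont_on_cauchy_kernel c r (dcirc r) 2 w Cd Hw).
    assert (E : cint (fun t => (- (1) * (dcirc r t * (/ (circ c r t - w)) ^ 2))%C) 0 (2 * PI)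
                = RtoC 0).
    { rewrite (cint_derive F).
      - unfold F, circ. rewrite polar_2PI. ring.
      - auto.
      - intros t Ht. rewrite <- EF. apply (rdiff_comp (fun x => / (x - w))%C (circ c r)).
        + apply cdiff_inv_shift; auto.
        + apply rdiff_circ.
      - intros t Ht. apply ccont_mult; [apply ccont_const|auto]. }
    rewrite cint_scal in E by auto.
    match goal with |- ?x = _ => replace x with (- (1) * (- (1) * x))%C by ring end.
    rewrite E; ring. }
  assert (Const : cauchy_transform c r (dcirc r) 1 z = cauchy_transform c r (dcirc r) 1 c).
  { apply C_eq_of_small. intros e He.
    set (F := fun t => cauchy_transform c r (dcirc r) 1 (c + RtoC t * (z - c))%C).
    replace (cauchy_transform c r (dcirc r) 1 z) with (F 1) by (unfold F; f_equal; ring).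
    replace (cauchy_transform c r (dcirc r) 1 c) with (F 0) by (unfold F; f_equal; ring).
    apply Rle_trans with (0 * Rabs (1 - 0)); [|lra].
    apply (lipschitz_of_rdiff_bound F (fun _ => RtoC 0) 0 1); try lra.
    2:{ intros; rewrite Cmod_0; lra. }
    intros t Ht.
    assert (D : Cmod (c + RtoC t * (z - c) - c) < r).
    { replace (c + RtoC t * (z - c) - c)%C with (RtoC t * (z - c))%C by ring.
      rewrite Cmod_mult, Cmod_R, Rabs_pos_eq by lra.
      apply Rle_lt_trans with (1 * Cmod (z - c)); [|lra].
      apply Rmult_le_compat_r; [apply Cmod_ge_0|lra]. }
    replace (RtoC 0) with (RtoC (INR 1)
      * cauchy_transform c r (dcirc r) 2 (c + RtoC t * (z - c)) * (z - c))%C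
      by (rewrite Z2 by auto; ring).
    apply (rdiff_comp (cauchy_transform c r (dcirc r) 1) (fun t => c + RtoC t * (z - c))%C).
    - apply cauchy_transform_derive with (B := r); auto.
      intros; rewrite Cmod_dcirc; auto; lra.
    - apply rdiff_line. }
  rewrite Const. unfold cauchy_transform.
  rewrite (cint_ext _ (fun _ => Ci)); auto.
  - rewrite (cint_derive (fun t => 0 + RtoC t * Ci)%C); auto.
    + ring.
    + intros; apply rdiff_line.
    + intros t _; apply ccont_const.
  - intros t _. unfold dcirc, circ.
    replace (c + polar r t - c)%C with (polar r t) by ring. simpl.
    field. apply Cmod_gt_0. rewrite Cmod_polar, Rabs_pos_eq; lra.
Qed.

Lemma RtoC_neq_0 (x : R) : x <> 0 -> RtoC x <> RtoC 0.
Proof. intros H E; apply RtoC_inj in E; auto. Qed.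

Lemma Ci_2PI_neq_0 : (Ci * RtoC (2 * PI))%C <> RtoC 0.
Proof.
  apply Cmult_neq_0.
  - intros E. apply (f_equal Cmod) in E. rewrite Cmod_Ci, Cmod_0 in E; lra.
  - apply RtoC_neq_0. generalize PI_RGT_0; lra.
Qed.

(** The vanishing integral of the difference quotient splits into the Cauchy integral of [f] and
    [f z] times the winding number. *)
Lemma cauchy_formula (f : C -> C) (c z : C) (r R0 : R) :
  (forall w, Cmod (w - c) < R0 -> exists l, cdiff f w l) ->
  0 < r < R0 -> Cmod (z - c) < r ->
  cauchy_transform c r (fun t => f (circ c r t) * dcirc r t)%C 1 z
  = (Ci * RtoC (2 * PI) * f z)%C.
Proof.
  intros Hf Hr Hz. assert (P2 := PI2_pos).
  assert (E := cauchy_difference_quotient f c z r R0 Hf Hr Hz).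
  assert (Cd : ccont_on (dcirc r) 0 (2 * PI)) by (intros t _; apply ccont_dcirc).
  assert (Cf : ccont_on (fun t => f (circ c r t) * dcirc r t)%C 0 (2 * PI)).
  { intros t Ht. apply ccont_mult; [|auto].
    destruct (Hf (circ c r t)) as [l Hl]; [rewrite circ_dist_center; lra|].
    apply (ccont_comp f (circ c r) t l Hl). eapply ccont_rdiff, rdiff_circ. }
  rewrite (cint_ext _ (fun t =>
     (f (circ c r t) * dcirc r t) * (/ (circ c r t - z)) ^ 1
     - f z * (dcirc r t * (/ (circ c r t - z)) ^ 1))%C) in E by (auto; intros; ring).
  assert (C1 := ccont_on_cauchy_kernel c r _ 1 z Cf Hz).
  assert (C2 := ccont_on_cauchy_kernel c r _ 1 z Cd Hz).
  rewrite cint_minus, cint_scal in E; auto.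
  2:{ intros t Ht. apply ccont_mult; [apply ccont_const|auto]. }
  fold (cauchy_transform c r (dcirc r) 1 z) in E.
  fold (cauchy_transform c r (fun t => f (circ c r t) * dcirc r t)%C 1 z) in E.
  rewrite winding_number in E by auto.
  match type of E with (?x - ?y)%C = _ =>
    replace x with ((x - y) + y)%C by ring; rewrite E; ring end.
Qed.

(** [G k] is [k! / (2 i PI)] times the transform of exponent [k + 1]: each differentiation raises
    the exponent by one and brings out the next factor of the factorial. The bound is taken at the
    centre, whose distance to every point of the circle is exactly [r]. *)
Theorem disc_derivatives (f : C -> C) (c : C) (r R0 M : R) :
  (forall w, Cmod (w - c) < R0 -> exists l, cdiff f w l) ->
  (forall w, Cmod (w - c) < R0 -> Cmod (f w) <= M) ->
  0 < r < R0 ->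
  exists G : nat -> C -> C,
    (forall z, Cmod (z - c) < r -> G O z = f z) /\
    (forall k z, Cmod (z - c) < r -> cdiff (G k) z (G (S k) z)) /\
    (forall k, Cmod (G k c) <= M * INR (fact k) / r ^ k).
Proof.
  intros Hf HM Hr. assert (P2 := PI2_pos). assert (HPI := PI_RGT_0).
  set (phi := fun t => (f (circ c r t) * dcirc r t)%C).
  assert (Hin : forall t, Cmod (circ c r t - c) < R0)
    by (intros t; rewrite circ_dist_center; lra).
  assert (Cphi : ccont_on phi 0 (2 * PI)).
  { intros t Ht. apply ccont_mult; [|apply ccont_dcirc].
    destruct (Hf (circ c r t) (Hin t)) as [l Hl].
    apply (ccont_comp f (circ c r) t l Hl). eapply ccont_rdiff, rdiff_circ. }
  assert (HB : forall t, 0 <= t <= 2 * PI -> Cmod (phi t) <= M * r).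
  { intros t _. unfold phi. rewrite Cmod_mult, Cmod_dcirc by lra.
    apply Rmult_le_compat_r; [lra|auto]. }
  set (G := fun k z => (RtoC (INR (fact k)) / (Ci * RtoC (2 * PI))
                        * cauchy_transform c r phi (S k) z)%C).
  assert (N := Ci_2PI_neq_0).
  exists G. repeat split.
  - intros z Hz. unfold G, phi. rewrite (cauchy_formula f c z r R0 Hf Hr Hz).
    simpl. field. split.
    + apply RtoC_neq_0; lra.
    + intros E; apply N; rewrite E; ring.
  - intros k z Hz. unfold G at 2.
    replace (RtoC (INR (fact (S k))) / (Ci * RtoC (2 * PI))
             * cauchy_transform c r phi (S (S k)) z)%C
      with (RtoC (INR (fact k)) / (Ci * RtoC (2 * PI))
            * (RtoC (INR (S k)) * cauchy_transform c r phi (S (S k)) z))%C.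
    + apply cdiff_scal. apply cauchy_transform_derive with (B := M * r); auto.
    + rewrite fact_simpl, mult_INR, (RtoC_mult (INR (S k))). unfold Cdiv. ring.
  - intros k. unfold G. rewrite Cmod_mult, Cmod_div by auto.
    rewrite Cmod_mult, Cmod_Ci, !Cmod_R, !Rabs_pos_eq by (try lra; apply pos_INR).
    assert (Pr : 0 < r ^ k) by (apply pow_lt; lra).
    assert (B : Cmod (cauchy_transform c r phi (S k) c) <= (2 * PI - 0) * (M * r / r ^ S k)).
    { apply cint_bound; auto.
      - apply ccont_on_cauchy_kernel; auto.
        replace (c - c)%C with (RtoC 0) by ring. rewrite Cmod_0; lra.
      - intros t Ht. rewrite Cmod_mult, Cmod_pow, Cmod_inv, circ_dist_center.
        + rewrite pow_inv. apply Rmult_le_compat_r; auto.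
          apply Rlt_le, Rinv_0_lt_compat, pow_lt; lra.
        + lra.
        + apply circ_neq. replace (c - c)%C with (RtoC 0) by ring. rewrite Cmod_0; lra. }
    apply Rle_trans with (INR (fact k) / (1 * (2 * PI)) * ((2 * PI - 0) * (M * r / r ^ S k))).
    + apply Rmult_le_compat_l; auto. apply Rle_div_r; [lra|].
      rewrite Rmult_0_l. apply pos_INR.
    + apply Req_le. simpl. field. lra.
Qed.

Lemma cdiff_inj (f : C -> C) (z l m : C) : cdiff f z l -> cdiff f z m -> l = m.
Proof. intros H1 H2. rewrite <- (cdiff_unique f z l H1). apply cdiff_unique, H2. Qed.

(** Stated for a chain of derivatives so that it applies directly to the explicit derivatives of
    [f - P_n]. Uniqueness of derivatives identifies the chain with the one built from Cauchy
    integrals. *)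
Theorem cauchy_estimate (F : nat -> C -> C) (c : C) (r R0 M : R) :
  (forall k w, Cmod (w - c) < R0 -> cdiff (F k) w (F (S k) w)) ->
  (forall w, Cmod (w - c) < R0 -> Cmod (F O w) <= M) ->
  0 < r < R0 ->
  forall n, Cmod (F n c) <= M * INR (fact n) / r ^ n.
Proof.
  intros HF HM Hr.
  destruct (disc_derivatives (F O) c r R0 M) as (G & G0 & G1 & G2); auto.
  { intros w Hw; exists (F 1%nat w); auto. }
  assert (E : forall n z, Cmod (z - c) < r -> G n z = F n z).
  { induction n as [|n IH]; auto. intros z Hz.
    apply (cdiff_inj (F n) z); [|apply HF; lra].
    apply cdiff_ext_loc with (f := G n) (d := r - Cmod (z - c)); auto; [lra|].
    intros w Hw. apply IH.
    eapply Rle_lt_trans; [apply (Cmod_sub_triangle _ z)|]. lra. }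
  intros n. rewrite <- E; auto.
  replace (c - c)%C with (RtoC 0) by ring. rewrite Cmod_0; lra.
Qed.

(** * Holomorphic functions on open sets *)

Definition C_open (D : C -> Prop) : Prop :=
  forall z, D z -> exists d, 0 < d /\ forall w, Cmod (w - z) < d -> D w.

(** The bound that [disc_derivatives] requires costs no compactness argument: differentiability at
    the centre makes [f] bounded on a small disc. The derivative of [f] agrees near [z] with [G 1],
    which is itself differentiable. *)
Lemma holomorphic_derive (D : C -> Prop) (f : C -> C) :
  C_open D -> (forall z, D z -> exists l, cdiff f z l) ->
  forall z, D z -> exists l, cdiff (C_derive f) z l.
Proof.
  intros HD Hf z Hz.
  destruct (HD z Hz) as [d [Hd Kd]].
  destruct (Hf z Hz) as [l Hl].
  destruct (cdiff_lipschitz f z l Hl) as [d' [Hd' Kd']].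
  assert (Hl0 := Cmod_ge_0 l).
  set (R0 := Rmin d d'). assert (HR0 : 0 < R0) by (apply Rmin_glb_lt; auto).
  destruct (disc_derivatives f z (R0 / 2) R0 (Cmod (f z) + (Cmod l + 1) * d'))
    as (G & G0 & G1 & _).
  - intros w Hw. apply Hf, Kd. eapply Rlt_le_trans; [exact Hw|apply Rmin_l].
  - intros w Hw.
    assert (H : Cmod (w - z) < d') by (eapply Rlt_le_trans; [exact Hw|apply Rmin_r]).
    assert (X := Kd' w H). assert (Y := Cmod_triangle_inv (f w) (f z)).
    assert ((Cmod l + 1) * Cmod (w - z) <= (Cmod l + 1) * d')
      by (apply Rmult_le_compat_l; lra). lra.
  - lra.
  - exists (G 2%nat z).
    apply cdiff_ext_loc with (f := G 1%nat) (d := R0 / 2); [lra| |].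
    + intros w Hw. symmetry. apply cdiff_unique.
      apply cdiff_ext_loc with (f := G O) (d := R0 / 2 - Cmod (w - z)); [lra| |auto].
      intros x Hx. apply G0.
      eapply Rle_lt_trans; [apply (Cmod_sub_triangle _ w)|]. lra.
    + apply G1. replace (z - z)%C with (RtoC 0) by ring. rewrite Cmod_0; lra.
Qed.

Theorem holomorphic_C_derive_n (D : C -> Prop) (f : C -> C) :
  C_open D -> holomorphic_on D f ->
  forall k z, D z -> cdiff (C_derive_n f k) z (C_derive_n f (S k) z).
Proof.
  intros HD Hf.
  assert (K : forall k z, D z -> exists l, cdiff (C_derive_n f k) z l).
  { induction k as [|k IH].
    - intros z Hz. destruct (Hf z Hz) as [l Hl]. exists l. apply is_derive_cdiff, Hl.
    - apply holomorphic_derive; auto. }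
  intros k z Hz. destruct (K k z Hz) as [l Hl].
  simpl. rewrite (cdiff_unique _ _ _ Hl). exact Hl.
Qed.

(** * Sectors and asymptotic expansions *)

Lemma polar_mult (a x b y : R) : (polar a x * polar b y)%C = polar (a * b) (x + y).
Proof.
  unfold polar. rewrite cos_plus, sin_plus.
  apply injective_projections; simpl; ring.
Qed.

Lemma polar_1_0 : polar 1 0 = RtoC 1.
Proof. unfold polar. rewrite cos_0, sin_0. apply injective_projections; simpl; ring. Qed.

Lemma Rabs_atan_le (t : R) : Rabs (atan t) <= Rabs t.
Proof.
  destruct (MVT_gen atan 0 t (fun x => / (1 + x ^ 2))) as [c [Hc E]].
  - intros x _. apply is_derive_Reals.
    apply derivable_pt_lim_atan.
  - intros x _. apply derivable_continuous_pt, derivable_pt_atan.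
  - rewrite atan_0, !Rminus_0_r in E. rewrite E, Rabs_mult.
    assert (0 <= c ^ 2) by apply pow2_ge_0.
    rewrite Rabs_pos_eq by (apply Rlt_le, Rinv_0_lt_compat; lra).
    rewrite <- (Rmult_1_l (Rabs t)) at 2.
    apply Rmult_le_compat_r; [apply Rabs_pos|].
    rewrite <- Rinv_1. apply Rinv_le_contravar; lra.
Qed.

Lemma polar_of_right_half_plane (q : C) :
  0 < Re q -> exists rho, 0 < rho /\ q = polar rho (atan (Im q / Re q)).
Proof.
  destruct q as [x y]; simpl. intros Hx.
  set (t := y / x).
  assert (P : 0 < sqrt (1 + t ^ 2)) by (apply sqrt_lt_R0; generalize (pow2_ge_0 t); lra).
  exists (x * sqrt (1 + t ^ 2)); split; [apply Rmult_lt_0_compat; auto|].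
  unfold polar. rewrite cos_atan, sin_atan.
  replace (1 + Rsqr t) with (1 + t ^ 2) by (unfold Rsqr; ring).
  set (q := sqrt (1 + t ^ 2)) in *.
  apply injective_projections; unfold fst, snd.
  - field. lra.
  - transitivity (x * t); [unfold t|]; field; lra.
Qed.

(** Turning by [- phi] brings the point near the positive real axis, where the arctangent is an
    argument. Turning back yields the determination close to [phi], so no branch has to be fixed.
    With [delta <= 1 / 2] the real part exceeds [rho / 2], whence the angle [2 * delta]. *)
Lemma polar_near (rho phi delta : R) (w : C) :
  0 < rho -> 0 < delta <= 1 / 2 -> Cmod (w - polar rho phi) < delta * rho ->
  exists rho' phi', 0 < rho' /\ w = polar rho' phi' /\
    Rabs (rho' - rho) < delta * rho /\ Rabs (phi' - phi) <= 2 * delta.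
Proof.
  intros Hrho Hd Hw.
  set (q := (w * polar 1 (- phi))%C).
  assert (Hq : Cmod (q - RtoC rho) < delta * rho).
  { replace (q - RtoC rho)%C with ((w - polar rho phi) * polar 1 (- phi))%C.
    - rewrite Cmod_mult, Cmod_polar, Rabs_R1, Rmult_1_r. auto.
    - unfold q. rewrite <- (Cmult_1_r (RtoC rho)).
      rewrite <- polar_1_0. replace 0 with (phi + - phi) by ring.
      replace (polar 1 (phi + - phi)) with (polar 1 phi * polar 1 (- phi))%C
        by (rewrite polar_mult; f_equal; ring).
      replace (polar rho phi) with (RtoC rho * polar 1 phi)%C
        by (unfold polar; apply injective_projections; simpl; ring).
      ring. }
  assert (HRe : Rabs (Re q - rho) < delta * rho).
  { eapply Rle_lt_trans; [|exact Hq].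
    replace (Re q - rho) with (Re (q - RtoC rho)%C) by (destruct q; reflexivity).
    apply re_le_Cmod. }
  assert (HIm : Rabs (Im q) < delta * rho).
  { eapply Rle_lt_trans; [|exact Hq].
    replace (Im q) with (Im (q - RtoC rho)%C) by (destruct q; simpl; ring).
    apply im_le_Cmod. }
  assert (Hdr : delta * rho <= rho / 2).
  { replace (rho / 2) with (1 / 2 * rho) by field. apply Rmult_le_compat_r; lra. }
  apply Rabs_def2 in HRe.
  assert (Hx : rho / 2 < Re q) by lra.
  destruct (polar_of_right_half_plane q) as [rho' [Hr' Eq]]; [lra|].
  set (psi := atan (Im q / Re q)) in *.
  assert (Ew : w = polar rho' (psi + phi)).
  { replace w with (q * polar 1 phi)%C.
    - rewrite Eq at 1. rewrite polar_mult. f_equal; ring.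
    - unfold q. rewrite <- Cmult_assoc, polar_mult.
      replace (polar (1 * 1) (- phi + phi)) with (polar 1 0) by (f_equal; ring).
      rewrite polar_1_0. ring. }
  exists rho', (psi + phi). repeat split; auto.
  - assert (M1 : Cmod w = rho') by (rewrite Ew, Cmod_polar, Rabs_pos_eq; lra).
    assert (M2 : Cmod (polar rho phi) = rho) by (rewrite Cmod_polar, Rabs_pos_eq; lra).
    assert (T1 := Cmod_triangle_inv w (polar rho phi)).
    assert (T2 := Cmod_triangle_inv (polar rho phi) w).
    rewrite (Cmod_sub_sym (polar rho phi) w) in T2.
    apply Rabs_def1; lra.
  - replace (psi + phi - phi) with psi by ring.
    eapply Rle_trans; [apply Rabs_atan_le|].
    unfold Rdiv. rewrite Rabs_mult, (Rabs_pos_eq (/ Re q))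
      by (apply Rlt_le, Rinv_0_lt_compat; lra).
    apply Rle_div_l; [lra|].
    assert (delta * rho <= 2 * delta * Re q); [|lra].
    replace (delta * rho) with (2 * delta * (rho / 2)) by field.
    apply Rmult_le_compat_l; lra.
Qed.

Lemma open_in_sector (S : sector) : C_open (in_sector S).
Proof.
  intros z (rho & phi & Hr & Hp & ->).
  set (delta := Rmin (1 / 2) (Rmin ((sec_r S - rho) / rho)
                 (Rmin ((sec_theta S - phi) / 4) ((phi - sec_eta S) / 4)))).
  assert (0 < (sec_r S - rho) / rho) by (apply Rdiv_lt_0_compat; lra).
  assert (P : 0 < delta) by (unfold delta; repeat apply Rmin_glb_lt; lra).
  assert (D1 : delta <= 1 / 2) by apply Rmin_l.
  assert (D2 : delta <= (sec_r S - rho) / rho)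
    by (eapply Rle_trans; [apply Rmin_r|apply Rmin_l]).
  assert (D3 : delta <= (sec_theta S - phi) / 4)
    by (eapply Rle_trans; [apply Rmin_r|]; eapply Rle_trans; [apply Rmin_r|apply Rmin_l]).
  assert (D4 : delta <= (phi - sec_eta S) / 4)
    by (eapply Rle_trans; [apply Rmin_r|]; eapply Rle_trans; [apply Rmin_r|apply Rmin_r]).
  apply Rle_div_r in D2; [|lra].
  exists (delta * rho); split; [apply Rmult_lt_0_compat; lra|].
  intros w Hw.
  destruct (polar_near rho phi delta w) as (rho' & phi' & H1 & H2 & H3 & H4); auto; try lra.
  apply Rabs_def2 in H3. apply Rabs_le_between in H4.
  exists rho', phi'. repeat split; auto; lra.
Qed.

Lemma in_sector_incl (S' S : sector) (z : C) :
  sec_r S' <= sec_r S -> sec_eta S <= sec_eta S' -> sec_theta S' <= sec_theta S ->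
  in_sector S' z -> in_sector S z.
Proof.
  intros H1 H2 H3 (rho & phi & Hr & Hp & E). exists rho, phi. repeat split; auto; lra.
Qed.

Lemma proper_subsector_incl (S' S : sector) (z : C) :
  proper_subsector S' S -> in_sector S' z -> in_sector S z.
Proof. intros (H1 & H2 & H3). apply in_sector_incl; lra. Qed.

(** The radius must be proportional to [Cmod z], since the sector narrows towards the vertex; this
    is also what lets the powers of [Cmod z] cancel in Cauchy's estimate. The data of [T] are the
    means of those of [S'] and [S]. *)
Lemma conical_neighborhood (S' S : sector) :
  proper_subsector S' S -> exists T delta,
    proper_subsector T S /\ 0 < delta /\
    forall z w, in_sector S' z -> Cmod (w - z) < delta * Cmod z ->
      in_sector T w /\ Cmod w <= 2 * Cmod z.
Proof.
  intros (H1 & H2 & H3).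
  assert (P1 := sec_r_pos S'). assert (P2 := sec_opening_pos S').
  assert (P3 := sec_opening_le S).
  assert (Q1 : 0 < (sec_r S' + sec_r S) / 2) by lra.
  assert (Q2 : 0 < (sec_theta S' + sec_theta S) / 2 - (sec_eta S' + sec_eta S) / 2) by lra.
  assert (Q3 : (sec_theta S' + sec_theta S) / 2 - (sec_eta S' + sec_eta S) / 2 <= 2 * PI) by lra.
  set (T := Sector _ _ _ Q1 Q2 Q3).
  (* The angle moves by at most [2 * delta], half the gap to [S] and thus the gap to [T]; the
     modulus grows by at most [delta * sec_r S'], within the gap of the radii. The bound [1 / 2]
     also yields the factor 2 for [Cmod w]. *)
  set (delta := Rmin (1 / 2) (Rmin ((sec_r S - sec_r S') / (2 * sec_r S'))
                 (Rmin ((sec_theta S - sec_theta S') / 4) ((sec_eta S' - sec_eta S) / 4)))).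
  assert (0 < (sec_r S - sec_r S') / (2 * sec_r S')) by (apply Rdiv_lt_0_compat; lra).
  assert (P : 0 < delta) by (unfold delta; repeat apply Rmin_glb_lt; lra).
  assert (D1 : delta <= 1 / 2) by apply Rmin_l.
  assert (D2 : delta <= (sec_r S - sec_r S') / (2 * sec_r S'))
    by (eapply Rle_trans; [apply Rmin_r|apply Rmin_l]).
  assert (D3 : delta <= (sec_theta S - sec_theta S') / 4)
    by (eapply Rle_trans; [apply Rmin_r|]; eapply Rle_trans; [apply Rmin_r|apply Rmin_l]).
  assert (D4 : delta <= (sec_eta S' - sec_eta S) / 4)
    by (eapply Rle_trans; [apply Rmin_r|]; eapply Rle_trans; [apply Rmin_r|apply Rmin_r]).
  apply Rle_div_r in D2; [|lra].
  exists T, delta. split; [|split; auto].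
  { unfold proper_subsector, T; simpl; lra. }
  intros z w (rho & phi & Hr & Hp & ->) Hw.
  assert (M : Cmod (polar rho phi) = rho) by (rewrite Cmod_polar, Rabs_pos_eq; lra).
  split.
  - rewrite M in Hw.
    destruct (polar_near rho phi delta w) as (rho' & phi' & K1 & K2 & K3 & K4); auto; try lra.
    apply Rabs_def2 in K3. apply Rabs_le_between in K4.
    assert (delta * rho <= delta * sec_r S') by (apply Rmult_le_compat_l; lra).
    exists rho', phi'. unfold T; simpl. repeat split; auto; lra.
  - generalize (Cmod_triangle_inv w (polar rho phi)). rewrite M in *.
    assert (delta * rho <= 1 / 2 * rho) by (apply Rmult_le_compat_r; lra). lra.
Qed.

(** * Partial sums of the formal series *)

Lemma series_partial_S (a : nat -> C) (n : nat) (z : C) :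
  series_partial a (S n) z = (series_partial a n z + series_term a z n)%C.
Proof.
  destruct n as [|n].
  - simpl. rewrite sum_O. ring.
  - simpl series_partial. rewrite sum_Sn. reflexivity.
Qed.

Lemma series_partial_ext (a b : nat -> C) (n : nat) (z : C) :
  (forall k, a k = b k) -> series_partial a n z = series_partial b n z.
Proof.
  intros E. induction n as [|n IH]; auto.
  rewrite !series_partial_S, IH. unfold series_term. rewrite E; auto.
Qed.

Lemma INR_fact_pos (n : nat) : 0 < INR (fact n).
Proof. apply lt_0_INR, lt_O_fact. Qed.

(** Because of the factorials, differentiating a partial sum shifts the coefficients and drops one
    term. This drives both inductions on the order below. *)
Lemma cdiff_series_partial (a : nat -> C) (n : nat) (z : C) :
  cdiff (series_partial a (S n)) z (series_partial (fun k => a (S k)) n z).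
Proof.
  induction n as [|n IH].
  - apply cdiff_ext_loc with (f := fun _ => a O) (d := 1); [lra| |apply cdiff_const].
    intros w _. rewrite series_partial_S. unfold series_term. simpl. field.
  - rewrite series_partial_S.
    apply cdiff_ext_loc with (d := 1)
      (f := fun w => (series_partial a (S n) w + a (S n) / RtoC (INR (fact (S n))) * w ^ S n)%C);
      [lra|intros; rewrite (series_partial_S a (S n)); auto|].
    apply cdiff_plus; auto.
    unfold series_term.
    replace (a (S n) / RtoC (INR (fact n)) * z ^ n)%C
      with (a (S n) / RtoC (INR (fact (S n))) * (RtoC (INR (S n)) * z ^ n))%C.
    + apply cdiff_scal, cdiff_pow_S.
    + rewrite fact_simpl, mult_INR, RtoC_mult. field.
      split; apply RtoC_neq_0.
      * apply Rgt_not_eq, INR_fact_pos.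
      * apply not_0_INR; lia.
Qed.

Lemma series_partial_0 (a : nat -> C) (n : nat) : series_partial a (S n) 0 = a O.
Proof.
  induction n as [|n IH].
  - rewrite series_partial_S. unfold series_term; simpl. field.
  - rewrite series_partial_S, IH. unfold series_term. rewrite Cpow_S. ring.
Qed.

Lemma Rpower_split (x s : R) : 0 < x -> Rpower x s = Rpower x (s - 1) * x.
Proof.
  intros Hx. rewrite <- (Rpower_1 x) at 3 by auto. rewrite <- Rpower_plus. f_equal; ring.
Qed.

Theorem gevrey_of_asymptotic (s : R) (S : sector) (f : C -> C) (a : nat -> C) :
  holomorphic_on (in_sector S) f -> asymptotic_expansion s S f a -> gevrey_class s S f.
Proof.
  intros Hf Ha. split; auto. intros S' HS'.
  destruct (conical_neighborhood S' S HS') as (T & delta & HT & Hd & HN).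
  destruct (Ha T HT) as (M & K & HM & HK & Hasym).
  assert (HD := holomorphic_C_derive_n _ f (open_in_sector S) Hf).
  (* One factor 2 comes from [Cmod w <= 2 * Cmod z], the other from applying Cauchy's estimate at
     half the radius [delta * Cmod z]. The factorial of that estimate raises the exponent [s - 1] to
     [s]. *)
  exists M, (4 * K / delta). split; auto. split.
  { apply Rdiv_lt_0_compat; lra. }
  intros n z Hz.
  assert (Pz : 0 < Cmod z).
  { destruct Hz as (rho & phi & Hr & _ & ->). rewrite Cmod_polar, Rabs_pos_eq; lra. }
  (* The derivatives of [f - P_n]. At [k = n] the polynomial is empty, so [F n] is the derivative of
     [f]; beyond [n] the truncated subtraction keeps it empty and the chain goes on. *)
  set (F := fun k w => (C_derive_n f k w - series_partial (fun j => a (k + j)%nat) (n - k) w)%C).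
  assert (E : C_derive_n f n z = F n z).
  { unfold F. rewrite Nat.sub_diag. simpl. ring. }
  assert (Pd : 0 < delta * Cmod z) by (apply Rmult_lt_0_compat; auto).
  assert (PR : 0 < Rpower (INR (fact n)) (s - 1)) by apply exp_pos.
  assert (PK : 0 < K ^ n) by (apply pow_lt; auto).
  rewrite E.
  eapply Rle_trans.
  - apply (cauchy_estimate F z (delta * Cmod z / 2) (delta * Cmod z)
       (M * K ^ n * Rpower (INR (fact n)) (s - 1) * (2 * Cmod z) ^ n)); [| |lra].
    + intros k w Hw. destruct (HN z w Hz Hw) as [Hin _].
      apply cdiff_minus; [apply HD, (proper_subsector_incl T); auto|].
      destruct (n - k)%nat as [|m] eqn:Em.
      * replace (n - Datatypes.S k)%nat with O by lia. apply cdiff_const.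
      * replace (n - Datatypes.S k)%nat with m by lia.
        rewrite (series_partial_ext (fun j => a (Datatypes.S k + j)%nat)
                   (fun j => a (k + Datatypes.S j)%nat)) by (intros; f_equal; lia).
        apply (cdiff_series_partial (fun j => a (k + j)%nat)).
    + intros w Hw. destruct (HN z w Hz Hw) as [Hin Hle].
      unfold F. simpl C_derive_n. rewrite Nat.sub_0_r.
      eapply Rle_trans; [apply (Hasym n w Hin)|].
      apply Rmult_le_compat_l.
      * apply Rmult_le_pos; [apply Rmult_le_pos|]; lra.
      * apply pow_incr. split; [apply Cmod_ge_0|auto].
  - apply Req_le. rewrite (Rpower_split _ s) by apply INR_fact_pos.
    unfold Rdiv. rewrite !Rpow_mult_distr, !pow_inv.
    replace 4 with (2 * 2) by ring. rewrite !Rpow_mult_distr.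
    field. repeat split; apply pow_nonzero; lra.
Qed.

(* Integrating along the ray from the vertex, [f - P_(n+1)] is estimated from
   its derivative [f' - P_n], where [P_n] uses the shifted coefficients. *)
Lemma taylor_along_ray (n : nat) : forall (F : nat -> C -> C) (a : nat -> C) (phi r B : R),
  (forall k t, 0 < t < r -> cdiff (F k) (polar t phi) (F (S k) (polar t phi))) ->
  (forall k eps, 0 < eps -> exists d, 0 < d /\
     forall t, 0 < t < r -> t < d -> Cmod (F k (polar t phi) - a k) <= eps) ->
  (forall t, 0 < t < r -> Cmod (F n (polar t phi)) <= B) ->
  forall t, 0 < t < r ->
    Cmod (F O (polar t phi) - series_partial a n (polar t phi)) <= B * t ^ n / INR (fact n).
Proof.
  induction n as [|n IH]; intros F a phi r B HF Ha HB t Ht.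
  - simpl. replace (F O (polar t phi) - 0)%C with (F O (polar t phi)) by ring.
    specialize (HB t Ht). lra.
  - assert (HB0 : 0 <= B) by (eapply Rle_trans; [apply Cmod_ge_0|exact (HB t Ht)]).
    assert (IH' := IH (fun k => F (S k)) (fun k => a (S k)) phi r B
      (fun k => HF (S k)) (fun k => Ha (S k)) HB).
    set (Rm := fun w => (F O w - series_partial a (S n) w)%C).
    assert (Pf := INR_fact_pos n). assert (PSf := INR_fact_pos (S n)).
    (* The majorant [B * y ^ S n / (S n)!] has the bound of the induction hypothesis as its
       derivative. The ray is cut at [x > 0] because nothing is assumed about [F] at the vertex
       itself. *)
    assert (Inc : forall x, 0 < x <= t ->
      Cmod (Rm (polar t phi) - Rm (polar x phi))
      <= B * t ^ S n / INR (fact (S n)) - B * x ^ S n / INR (fact (S n))).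
    { intros x Hx.
      apply (mean_value_inequality (fun y => Rm (polar y phi))
        (fun y => (F 1%nat (polar y phi) - series_partial (fun k => a (S k)) n (polar y phi))
                  * polar 1 phi)%C
        (fun y => B * y ^ S n / INR (fact (S n))) (fun y => B * y ^ n / INR (fact n))); [lra| | |].
      - intros y Hy. apply (rdiff_comp Rm (fun y => polar y phi)).
        + apply cdiff_minus; [apply HF; lra|apply cdiff_series_partial].
        + apply rdiff_polar_radius.
      - intros y Hy. rewrite fact_simpl, mult_INR.
        auto_derive; auto. change (match n with O => 1 | S _ => INR n + 1 end) with (INR (S n)).
        rewrite S_INR. simpl pred. field. split; [apply Rgt_not_eq; auto|]. generalize (pos_INR n); lra.
      - intros y Hy. rewrite Cmod_mult, Cmod_polar, Rabs_R1, Rmult_1_r. apply IH'; lra. }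
    apply le_epsilon. intros e He.
    destruct (Ha O (e / 2)) as [d1 [Hd1 K1]]; [lra|].
    destruct (cdiff_lipschitz _ _ _ (cdiff_series_partial a n 0)) as [d2 [Hd2 K2]].
    set (L := Cmod (series_partial (fun k => a (S k)) n 0) + 1) in *.
    assert (HL : 0 < L)
      by (unfold L; generalize (Cmod_ge_0 (series_partial (fun k => a (S k)) n 0)); lra).
    (* Near the vertex [F O] and the partial sum both approach [a O]. Each gets half of [e]: the
       former through [d1], the latter through its Lipschitz constant [L], valid within [d2]. *)
    set (d := Rmin t (Rmin d1 (Rmin d2 (e / (2 * L))))).
    assert (Q : 0 < e / (2 * L)) by (apply Rdiv_lt_0_compat; lra).
    assert (Pd : 0 < d) by (unfold d; repeat apply Rmin_glb_lt; lra).
    assert (E1 : d <= t) by apply Rmin_l.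
    assert (E2 : d <= d1) by (eapply Rle_trans; [apply Rmin_r|apply Rmin_l]).
    assert (E3 : d <= d2)
      by (eapply Rle_trans; [apply Rmin_r|]; eapply Rle_trans; [apply Rmin_r|apply Rmin_l]).
    assert (E4 : d <= e / (2 * L))
      by (eapply Rle_trans; [apply Rmin_r|]; eapply Rle_trans; [apply Rmin_r|apply Rmin_r]).
    set (x := d / 2). assert (Hx : 0 < x < d) by (unfold x; lra).
    assert (I := Inc x ltac:(lra)).
    assert (J1 := K1 x ltac:(lra) ltac:(lra)).
    assert (Mx : Cmod (polar x phi - 0) = x).
    { replace (polar x phi - 0)%C with (polar x phi) by ring.
      rewrite Cmod_polar, Rabs_pos_eq; lra. }
    assert (J2 := K2 (polar x phi)). rewrite Mx, series_partial_0 in J2.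
    specialize (J2 ltac:(lra)).
    assert (L * x <= e / 2).
    { apply Rle_trans with (L * (e / (2 * L))).
      - apply Rmult_le_compat_l; lra.
      - apply Req_le; field; lra. }
    assert (J3 : Cmod (Rm (polar x phi)) <= e).
    { unfold Rm.
      replace (F O (polar x phi) - series_partial a (S n) (polar x phi))%C
        with ((F O (polar x phi) - a O) - (series_partial a (S n) (polar x phi) - a O))%C by ring.
      eapply Rle_trans; [apply Cmod_triangle_minus|]. lra. }
    assert (0 <= B * x ^ S n / INR (fact (S n))).
    { apply Rle_div_r; auto. rewrite Rmult_0_l.
      apply Rmult_le_pos; auto. apply pow_le; lra. }
    fold (Rm (polar t phi)).
    generalize (Cmod_triangle_inv (Rm (polar t phi)) (Rm (polar x phi))). lra.
Qed.

(** The path runs along a ray and then along an arc, because a segment may leave a sector of opening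
    greater than [PI]. The bound by [rho + rho'] instead of the distance suffices for limits at the
    vertex. *)
Lemma sector_lipschitz (T : sector) (f df : C -> C) (B : R) :
  (forall z, in_sector T z -> cdiff f z (df z)) ->
  (forall z, in_sector T z -> Cmod (df z) <= B) ->
  forall rho phi rho' phi',
    0 < rho < sec_r T -> 0 < rho' < sec_r T ->
    sec_eta T < phi < sec_theta T -> sec_eta T < phi' < sec_theta T ->
    Cmod (f (polar rho phi) - f (polar rho' phi')) <= 9 * B * (rho + rho').
Proof.
  intros Hf HB rho phi rho' phi' Hr Hr' Hp Hp'.
  assert (HB0 : 0 <= B).
  { eapply Rle_trans; [apply Cmod_ge_0|apply (HB (polar rho phi))].
    exists rho, phi; auto. }
  eapply Rle_trans; [apply (Cmod_sub_triangle _ (f (polar rho' phi)))|].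
  assert (Ray : Cmod (f (polar rho phi) - f (polar rho' phi)) <= B * Rabs (rho - rho')).
  { assert (X1 := Rmin_l rho rho').
    assert (X2 := Rmin_r rho rho'). assert (X3 := Rmax_l rho rho').
    assert (X4 := Rmax_r rho rho').
    assert (0 < Rmin rho rho') by (apply Rmin_glb_lt; lra).
    assert (Rmax rho rho' < sec_r T) by (apply Rmax_lub_lt; lra).
    apply (lipschitz_of_rdiff_bound (fun t => f (polar t phi))
      (fun t => df (polar t phi) * polar 1 phi)%C (Rmin rho rho') (Rmax rho rho')); try lra.
    - intros t Ht. apply (rdiff_comp f (fun t => polar t phi)).
      + apply Hf. exists t, phi. repeat split; auto; lra.
      + apply rdiff_polar_radius.
    - intros t Ht. rewrite Cmod_mult, Cmod_polar, Rabs_R1, Rmult_1_r.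
      apply HB. exists t, phi. repeat split; auto; lra. }
  assert (Arc : Cmod (f (polar rho' phi) - f (polar rho' phi')) <= B * rho' * Rabs (phi - phi')).
  { assert (X1 := Rmin_l phi phi').
    assert (X2 := Rmin_r phi phi'). assert (X3 := Rmax_l phi phi').
    assert (X4 := Rmax_r phi phi').
    assert (sec_eta T < Rmin phi phi') by (apply Rmin_glb_lt; lra).
    assert (Rmax phi phi' < sec_theta T) by (apply Rmax_lub_lt; lra).
    apply (lipschitz_of_rdiff_bound (fun t => f (polar rho' t))
      (fun t => df (polar rho' t) * (Ci * polar rho' t))%C (Rmin phi phi') (Rmax phi phi'));
      try lra.
    - intros t Ht. apply (rdiff_comp f (polar rho')).
      + apply Hf. exists rho', t. repeat split; auto; lra.
      + apply rdiff_polar_angle.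
    - intros t Ht. rewrite !Cmod_mult, Cmod_Ci, Cmod_polar, (Rabs_pos_eq rho'), Rmult_1_l by lra.
      apply Rmult_le_compat_r; [lra|].
      apply HB. exists rho', t. repeat split; auto; lra. }
  (* The constant 9 is 1 for the ray plus 8 for the arc, whose angle is at most [2 * PI <= 8]. *)
  assert (O := sec_opening_le T). assert (P4 := PI_4).
  assert (Rabs (phi - phi') <= 8) by (apply Rabs_le; lra).
  assert (Rabs (rho - rho') <= rho + rho') by (apply Rabs_le; lra).
  assert (B * Rabs (rho - rho') <= B * (rho + rho')) by (apply Rmult_le_compat_l; auto).
  assert (B * rho' * Rabs (phi - phi') <= B * rho' * 8)
    by (apply Rmult_le_compat_l; auto; apply Rmult_le_pos; lra).
  assert (0 <= B * rho) by (apply Rmult_le_pos; lra).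
  lra.
Qed.

Definition Clim_seq (u : nat -> C) : C :=
  (real (Lim_seq (fun n => Re (u n))), real (Lim_seq (fun n => Im (u n)))).

Lemma Clim_seq_cauchy (u : nat -> C) :
  (forall eps, 0 < eps -> exists N, forall n m, (N <= n)%nat -> (N <= m)%nat ->
     Cmod (u n - u m) < eps) ->
  forall eps, 0 < eps -> exists N, forall n, (N <= n)%nat -> Cmod (u n - Clim_seq u) < eps.
Proof.
  intros H eps He.
  assert (HR : ex_finite_lim_seq (fun n => Re (u n))).
  { apply ex_lim_seq_cauchy_corr. intros e. destruct (H e (cond_pos e)) as [N HN].
    exists N. intros n m Hn Hm. eapply Rle_lt_trans; [|apply (HN n m Hn Hm)].
    replace (Re (u n) - Re (u m)) with (Re (u n - u m)%C)
      by (destruct (u n), (u m); reflexivity). apply re_le_Cmod. }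
  assert (HI : ex_finite_lim_seq (fun n => Im (u n))).
  { apply ex_lim_seq_cauchy_corr. intros e. destruct (H e (cond_pos e)) as [N HN].
    exists N. intros n m Hn Hm. eapply Rle_lt_trans; [|apply (HN n m Hn Hm)].
    replace (Im (u n) - Im (u m)) with (Im (u n - u m)%C)
      by (destruct (u n), (u m); reflexivity). apply im_le_Cmod. }
  apply Lim_seq_correct', is_lim_seq_spec in HR.
  apply Lim_seq_correct', is_lim_seq_spec in HI.
  assert (He2 : 0 < eps / 2) by lra.
  destruct (HR (mkposreal _ He2)) as [N1 K1]. destruct (HI (mkposreal _ He2)) as [N2 K2].
  exists (max N1 N2). intros n Hn.
  specialize (K1 n ltac:(lia)). specialize (K2 n ltac:(lia)). simpl in K1, K2.
  eapply Rle_lt_trans; [apply Cmod_le_re_im|].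
  unfold Clim_seq.
  replace (Re (u n - (real (Lim_seq (fun n => Re (u n))), real (Lim_seq (fun n => Im (u n)))))%C)
    with (Re (u n) - real (Lim_seq (fun n => Re (u n)))) by (destruct (u n); reflexivity).
  replace (Im (u n - (real (Lim_seq (fun n => Re (u n))), real (Lim_seq (fun n => Im (u n)))))%C)
    with (Im (u n) - real (Lim_seq (fun n => Im (u n)))) by (destruct (u n); reflexivity).
  lra.
Qed.

(** The bisector depends on [S] alone, so the value is the same for all subsectors. The shift
    [n + 2] keeps every sample point strictly inside the radius of [S]. As a total limit it is
    meaningful only where [vertex_limit_spec] applies. *)
Definition vertex_limit (S : sector) (f : C -> C) : C :=
  Clim_seq (fun n => f (polar (sec_r S / INR (n + 2)) ((sec_eta S + sec_theta S) / 2))).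

(** The bound of [sector_lipschitz] makes the samples on the bisector a Cauchy sequence; letting the
    second point run through them yields the same limit, with a linear rate, in every direction of
    [T]. *)
Lemma vertex_limit_spec (S T : sector) (f df : C -> C) (B : R) :
  (forall z, in_sector T z -> cdiff f z (df z)) ->
  (forall z, in_sector T z -> Cmod (df z) <= B) ->
  sec_eta T < (sec_eta S + sec_theta S) / 2 < sec_theta T ->
  forall rho phi, 0 < rho < sec_r T -> sec_eta T < phi < sec_theta T ->
    Cmod (f (polar rho phi) - vertex_limit S f) <= 9 * B * rho.
Proof.
  intros Hf HB Hmid rho phi Hr Hp.
  set (phi0 := (sec_eta S + sec_theta S) / 2) in *.
  set (x := fun n => sec_r S / INR (n + 2)).
  assert (PS := sec_r_pos S). assert (PT := sec_r_pos T).
  assert (Lip := sector_lipschitz T f df B Hf HB).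
  assert (HB0 : 0 <= B).
  { eapply Rle_trans; [apply Cmod_ge_0|apply (HB (polar rho phi))].
    exists rho, phi; auto. }
  assert (Hx : forall e, 0 < e -> exists N, forall n, (N <= n)%nat -> 0 < x n < e).
  { intros e He. destruct (archimed_cor1 (e / sec_r S)) as [N [HN HN0]];
      [apply Rdiv_lt_0_compat; auto|].
    exists N. intros n Hn. unfold x.
    assert (0 < INR N) by (apply lt_0_INR; auto).
    assert (INR N <= INR (n + 2)) by (apply le_INR; lia).
    split; [apply Rdiv_lt_0_compat; lra|].
    apply Rlt_div_r in HN; auto.
    apply Rle_lt_trans with (/ INR N * sec_r S); auto.
    unfold Rdiv. rewrite Rmult_comm. apply Rmult_le_compat_r; [lra|].
    apply Rinv_le_contravar; lra. }
  assert (Lim := Clim_seq_cauchy (fun n => f (polar (x n) phi0))).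
  match type of Lim with ?P -> _ => assert (Cau : P) end.
  { intros eps He.
    (* Two radii below this bound give [9 * B * (x n + x m) < eps]; the added 1 covers [B = 0]. *)
    destruct (Hx (Rmin (sec_r T) (eps / (18 * B + 1)))) as [N HN].
    { apply Rmin_glb_lt; auto. apply Rdiv_lt_0_compat; lra. }
    assert (Y : forall n, (N <= n)%nat -> 0 < x n < sec_r T /\ x n * (18 * B + 1) < eps).
    { intros n Hn. specialize (HN n Hn).
      assert (x n < sec_r T) by (eapply Rlt_le_trans; [apply HN|apply Rmin_l]).
      assert (Z : x n < eps / (18 * B + 1)) by (eapply Rlt_le_trans; [apply HN|apply Rmin_r]).
      apply Rlt_div_r in Z; lra. }
    exists N. intros n m Hn Hm.
    destruct (Y n Hn) as [Y1 Y2]. destruct (Y m Hm) as [Y3 Y4].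
    eapply Rle_lt_trans; [apply Lip; auto|]. lra. }
  specialize (Lim Cau).
  change (Clim_seq (fun n => f (polar (x n) phi0))) with (vertex_limit S f) in Lim.
  apply le_epsilon. intros e He.
  destruct (Lim (e / 2)) as [N1 K1]; [lra|].
  destruct (Hx (Rmin (sec_r T) (e / (18 * B + 1)))) as [N2 K2].
  { apply Rmin_glb_lt; auto. apply Rdiv_lt_0_compat; lra. }
  specialize (K1 (max N1 N2) ltac:(lia)). specialize (K2 (max N1 N2) ltac:(lia)).
  set (y := x (max N1 N2)) in *.
  assert (Y1 : y < sec_r T) by (eapply Rlt_le_trans; [apply K2|apply Rmin_l]).
  assert (Y2 : y < e / (18 * B + 1)) by (eapply Rlt_le_trans; [apply K2|apply Rmin_r]).
  apply Rlt_div_r in Y2; [|lra].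
  eapply Rle_trans; [apply (Cmod_sub_triangle _ (f (polar y phi0)))|].
  assert (Z := Lip rho phi y phi0 Hr ltac:(lra) Hp Hmid). lra.
Qed.

(** The coefficients are limits along the bisector of [S], which [S'] may miss. The angles of [S']
    are stretched to reach the bisector and then moved halfway to those of [S], which makes all
    inclusions strict. *)
Lemma subsector_through_bisector (S' S : sector) :
  proper_subsector S' S -> exists T,
    proper_subsector T S /\ sec_r S' <= sec_r T /\
    sec_eta T <= sec_eta S' /\ sec_theta S' <= sec_theta T /\
    sec_eta T < (sec_eta S + sec_theta S) / 2 < sec_theta T.
Proof.
  intros (H1 & H2 & H3).
  assert (P1 := sec_r_pos S'). assert (P2 := sec_opening_pos S').
  assert (P3 := sec_opening_le S). assert (P4 := sec_opening_pos S).
  set (m := (sec_eta S + sec_theta S) / 2).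
  assert (M1 := Rmin_l (sec_eta S') m). assert (M2 := Rmin_r (sec_eta S') m).
  assert (M3 := Rmax_l (sec_theta S') m). assert (M4 := Rmax_r (sec_theta S') m).
  assert (M5 : sec_eta S < Rmin (sec_eta S') m) by (apply Rmin_glb_lt; unfold m; lra).
  assert (M6 : Rmax (sec_theta S') m < sec_theta S) by (apply Rmax_lub_lt; unfold m; lra).
  assert (Q1 : 0 < (sec_r S' + sec_r S) / 2) by lra.
  assert (Q2 : 0 < (Rmax (sec_theta S') m + sec_theta S) / 2
                   - (Rmin (sec_eta S') m + sec_eta S) / 2) by lra.
  assert (Q3 : (Rmax (sec_theta S') m + sec_theta S) / 2
               - (Rmin (sec_eta S') m + sec_eta S) / 2 <= 2 * PI) by lra.
  exists (Sector _ _ _ Q1 Q2 Q3). unfold proper_subsector; simpl.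
  repeat split; lra.
Qed.

Theorem asymptotic_of_gevrey (s : R) (S : sector) (f : C -> C) :
  gevrey_class s S f ->
  asymptotic_expansion s S f (fun k => vertex_limit S (C_derive_n f k)).
Proof.
  intros [Hf HG] S' HS'.
  destruct (subsector_through_bisector S' S HS') as (T & HT & T1 & T2 & T3 & Tm).
  destruct (HG T HT) as (M & K & HM & HK & Hb).
  exists M, K. split; auto. split; auto.
  intros n z (rho & phi & Hr & Hp & ->).
  assert (HD := holomorphic_C_derive_n _ f (open_in_sector S) Hf).
  assert (HD' : forall k w, in_sector T w ->
            cdiff (C_derive_n f k) w (C_derive_n f (Datatypes.S k) w)).
  { intros k w Hw. apply HD, (proper_subsector_incl T); auto. }
  assert (Hray : forall t, 0 < t < sec_r T -> in_sector T (polar t phi)).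
  { intros t Ht. exists t, phi. repeat split; auto; lra. }
  rewrite Cmod_polar, Rabs_pos_eq by lra.
  assert (Pf := INR_fact_pos n).
  (* The division by [n!] in Taylor's estimate lowers the exponent [s] to [s - 1], so [M] and [K]
     are those of the derivative bounds on [T]. *)
  replace (M * K ^ n * Rpower (INR (fact n)) (s - 1) * rho ^ n)
    with (M * K ^ n * Rpower (INR (fact n)) s * rho ^ n / INR (fact n))
    by (rewrite (Rpower_split _ s) by auto; field; lra).
  apply (taylor_along_ray n (C_derive_n f) _ phi (sec_r T)); [| | |lra].
  - intros k t Ht. apply HD', Hray, Ht.
  - intros k eps He.
    (* The bound on the derivative of order [k + 1] makes the one of order [k] approach its limit
       within [9 * B * t]. *)
    set (B := M * K ^ (Datatypes.S k) * Rpower (INR (fact (Datatypes.S k))) s).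
    assert (HB0 : 0 < B).
    { unfold B. apply Rmult_lt_0_compat; [apply Rmult_lt_0_compat; auto; apply pow_lt; auto|].
      apply exp_pos. }
    exists (eps / (9 * B)); split; [apply Rdiv_lt_0_compat; lra|].
    intros t Ht Ht'. apply Rlt_div_r in Ht'; [|lra].
    apply Rle_trans with (9 * B * t); [|lra].
    apply (vertex_limit_spec S T (C_derive_n f k) (C_derive_n f (Datatypes.S k)));
      auto; lra.
  - intros t Ht. apply Hb, Hray, Ht.
Qed.

Theorem mainTheorem1 (s : R) (S : sector) (f : C -> C)
    (hs : 1 <= s) (hf : holomorphic_on (in_sector S) f) :
  gevrey_class s S f <->
  exists a : nat -> C, asymptotic_expansion s S f a.
Proof.
  split.
  - intros H. exists (fun k => vertex_limit S (C_derive_n f k)).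
    apply asymptotic_of_gevrey, H.
  - intros [a Ha]. exact (gevrey_of_asymptotic s S f a hf Ha).
Qed.
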